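(* For every $k\in\mathbb Z$, the function $v_k$ extends to a function of class $C^\infty$ on $P_*:=([0,+\infty)\times\mathbb R)\setminus\{(0,0)\}$ (all its derivatives extend continuously up to the boundary $\{x=0\}$ away from the origin).
   Context: Let $M(a,b,\zeta)=\sum_{n\ge0}\frac{(a)_n}{(b)_n}\frac{\zeta^n}{n!}$ be Kummer's function. For $k\in\mathbb Z$ define $$\Lambda_k(t)=9^{\frac16+k}(1+t^2)^{-\frac14-\frac{3k}2}\Big[\tfrac{\Gamma(1/3)}{\Gamma(1/6-k)}M\big(-\tfrac16-k,\tfrac23,-\tfrac{t^3}{9}\big)-\tfrac{t}{9^{1/3}}\tfrac{\Gamma(-1/3)}{\Gamma(-1/6-k)}M\big(\tfrac16-k,\tfrac43,-\tfrac{t^3}{9}\big)\Big],$$ and for $x>0$, $z\in\mathbb R$, $v_k(x,z):=r^{\frac12+3k}\Lambda_k(t)$ with $r=(z^2+x^{2/3})^{1/2}$, $t=zx^{-1/3}$. *)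

(* Defs.v *)
From Stdlib Require Import Reals Lra ZArith List.
From Coquelicot Require Import Coquelicot.
Open Scope R_scope.

Fixpoint poch (a : R) (n : nat) : R :=
  match n with
  | O => 1
  | S m => poch a m * (a + INR m)
  end.

Definition kummerM (a b z : R) : R :=
  Series (fun n => poch a n / poch b n * z ^ n / INR (fact n)).

Definition Gamma_pos (a : R) : R :=
  RInt_gen (fun t => Rpower t (a - 1) * exp (- t))
           (at_right 0) (Rbar_locally p_infty).

(* Gamma on all reals via the functional equation:
   Gamma a = Gamma (a+n) / ((a)(a+1)...(a+n-1)) with n such that a+n>0
   (well defined, i.e. the usual meromorphic continuation, for a not in -N). *)
Definition Gamma (a : R) : R :=
  let n := Z.to_nat (up (- a)) in
  Gamma_pos (a + INR n) / poch a n.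

Definition Lambda (k : Z) (t : R) : R :=
  let kR := IZR k in
  Rpower 9 (1/6 + kR) * Rpower (1 + t ^ 2) (- (1/4) - 3 * kR / 2) *
  ( Gamma (1/3) / Gamma (1/6 - kR) * kummerM (- (1/6) - kR) (2/3) (- (t ^ 3) / 9)
    - t / Rpower 9 (1/3) * (Gamma (- (1/3)) / Gamma (- (1/6) - kR))
        * kummerM (1/6 - kR) (4/3) (- (t ^ 3) / 9) ).

(* v_k(x,z) = r^(1/2+3k) Lambda_k(t), r = (z^2 + x^(2/3))^(1/2), t = z x^(-1/3),
   meaningful for x > 0. *)
Definition v (k : Z) (x z : R) : R :=
  let r := sqrt (z ^ 2 + Rpower x (2/3)) in
  let t := z * Rpower x (- (1/3)) in
  Rpower r (1/2 + 3 * IZR k) * Lambda k t.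

Definition partial_x (f : R -> R -> R) : R -> R -> R :=
  fun x z => Derive (fun s => f s z) x.
Definition partial_z (f : R -> R -> R) : R -> R -> R :=
  fun x z => Derive (fun s => f x s) z.

Fixpoint pderiv (l : list bool) (f : R -> R -> R) : R -> R -> R :=
  match l with
  | nil => f
  | b :: l' => if b then partial_x (pderiv l' f) else partial_z (pderiv l' f)
  end.

Definition ex_partial (b : bool) (f : R -> R -> R) (x z : R) : Prop :=
  if b then ex_derive (fun s => f s z) x else ex_derive (fun s => f x s) z.

Definition Hplus (p : R * R) : Prop := 0 < fst p.
Definition Pstar (p : R * R) : Prop := 0 <= fst p /\ p <> (0, 0).

Definition smooth_up_to_boundary (f : R -> R -> R) : Prop :=
  (forall (l : list bool) (b : bool) (x z : R), 0 < x ->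
      ex_partial b (pderiv l f) x z) /\
  (forall (l : list bool) (x z : R), 0 < x ->
      continuous (fun p : R * R => pderiv l f (fst p) (snd p)) (x, z)) /\
  (forall l : list bool, exists g : R * R -> R,
      (forall p, Hplus p -> g p = pderiv l f (fst p) (snd p)) /\
      (forall p, Pstar p -> filterlim g (within Pstar (locally p)) (locally (g p)))).

(* Main.v *)
Require Import Defs.
From Stdlib Require Import Reals ZArith Lra Lia.
From Coquelicot Require Import Coquelicot.
Open Scope R_scope.

(* On [x > 0] the function [v k] is a self-similar solution of [z dv/dx = d^2 v/dz^2]
   with [dv_k/dx = C_k v_(k-1)], and Euler's identity reads [3 x dv/dx + z dv/dz = (1/2 + 3k) v].
   Hence every partial derivative is a combination, with coefficients polynomial in [z], of the
   [v_j] and the [dv_j/dz], and by homogeneity it suffices that each [W = v_k(., 1)] and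
   [W = v_k(., -1)] has a limit at 0+.  If [v_(k-1)(., e)] is bounded near 0 then [v_k(., e)]
   has a limit, so boundedness for [k <= -2] is enough.  Both satisfy the second order equation
   [selfsim_ode].  At [z = 1] a quadratic Lyapunov function bounds [W].  At [z = -1] the general
   solution grows like [exp (1/(9x))]; the Gamma quotients in [v k] are exactly those for which
   the two growing parts cancel to leading order, since
   [sum Gamma(a+n)/(Gamma(2/3+n) n!) s^n] and its shift by 1/3 in [n] are asymptotically equal,
   and a maximum principle then forces [W] to be bounded. *)

(** * Kummer's function *)

(** For z < 0, with [a = v_a k] and s = -z^3/(9x), [v_k] is 9^(1/6+k) x^(-a) U(a, 2/3, s), where U
    is Tricomi's function: the solution of Kummer's equation that behaves like s^(-a) where the
    others grow like e^s. That behaviour is usually read off an integral representation of U. Here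
    only a weak form is established: the two positive series S and T whose difference is U, up to a
    constant factor, satisfy |S - T| = O(S/s), that is O(x S). This alone still permits exponential
    growth of W. It suffices because S is, up to a power of x, a positive solution of the same
    linear equation: for each eps > 0 the solutions eps S + W and eps S - W are nonnegative near 0,
    so they can be compared with a barrier, the resulting bound does not involve eps, and eps is
    sent to 0. For k <= -2 one has a >= 11/6. Then the zero-order coefficient 3a(3a+1) is positive,
    as the Lyapunov function and the barrier both require, and the Gamma arguments that depend on k
    are positive, so the series have positive terms and can be compared term by term. *)

Definition kummer_coef (a b : R) (n : nat) : R :=
  poch a n / poch b n / INR (fact n).

Lemma kummerM_PSeries (a b s : R) : kummerM a b s = PSeries (kummer_coef a b) s.
Proof.
  apply Series_ext; intros n; unfold kummer_coef, Rdiv; ring.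
Qed.

Lemma poch_pos (b : R) (n : nat) : 0 < b -> 0 < poch b n.
Proof.
  intros Hb; induction n as [|n IH]; simpl; [lra|].
  apply Rmult_lt_0_compat; [exact IH|].
  generalize (pos_INR n); lra.
Qed.

Lemma poch_S_l (c : R) (n : nat) : poch c (S n) = c * poch (c + 1) n.
Proof.
  induction n as [|n IH]; [simpl; ring|].
  change (poch c (S (S n))) with (poch c (S n) * (c + INR (S n))).
  rewrite IH, S_INR; simpl poch; ring.
Qed.

Lemma kummer_coef_S (a b : R) (n : nat) : 0 < b ->
  kummer_coef a b (S n) =
  kummer_coef a b n * ((a + INR n) / ((b + INR n) * (INR n + 1))).
Proof.
  intros Hb; unfold kummer_coef; rewrite fact_simpl, mult_INR, S_INR; simpl poch.
  generalize (poch_pos b n Hb) (pos_INR n) (INR_fact_lt_0 n); intros.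
  field; repeat split; lra.
Qed.

(** The ratio of consecutive coefficients is at most (1 + |a|/b)/(n+1) in absolute value, whatever
    the sign of [a]. The series is thus dominated by an exponential one, whence the infinite radius
    of convergence. *)
Lemma Rabs_kummer_coef_le (a b : R) (n : nat) : 0 < b ->
  Rabs (kummer_coef a b n) <= / INR (fact n) * (1 + Rabs a / b) ^ n.
Proof.
  intros Hb; induction n as [|n IH].
  - unfold kummer_coef; simpl; rewrite Rabs_right; lra.
  - rewrite kummer_coef_S, Rabs_mult by assumption.
    generalize (pos_INR n) (INR_fact_lt_0 n); intros Hn Hf.
    assert (Hq : Rabs ((a + INR n) / ((b + INR n) * (INR n + 1)))
                 <= (1 + Rabs a / b) / (INR n + 1)).
    { unfold Rdiv at 1; rewrite Rabs_mult, Rabs_inv.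
      rewrite (Rabs_right ((b + INR n) * (INR n + 1))) by nra.
      apply Rle_trans with ((Rabs a + INR n) * / ((b + INR n) * (INR n + 1))).
      - apply Rmult_le_compat_r; [apply Rlt_le, Rinv_0_lt_compat; nra|].
        apply Rle_trans with (1 := Rabs_triang _ _).
        rewrite (Rabs_right (INR n)); lra.
      - replace ((Rabs a + INR n) * / ((b + INR n) * (INR n + 1)))
          with ((Rabs a + INR n) / (b + INR n) / (INR n + 1)) by (field; lra).
        apply Rmult_le_compat_r; [apply Rlt_le, Rinv_0_lt_compat; lra|].
        apply Rle_div_l; [lra|].
        assert (0 <= Rabs a / b * INR n).
        { apply Rmult_le_pos; [|lra].
          apply Rmult_le_pos; [apply Rabs_pos|apply Rlt_le, Rinv_0_lt_compat; lra]. }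
        replace ((1 + Rabs a / b) * (b + INR n))
          with (b + INR n + Rabs a + Rabs a / b * INR n) by (field; lra).
        lra. }
    rewrite fact_simpl, mult_INR, S_INR; simpl pow.
    replace (/ ((INR n + 1) * INR (fact n)) * ((1 + Rabs a / b) * (1 + Rabs a / b) ^ n))
      with ((/ INR (fact n) * (1 + Rabs a / b) ^ n) * ((1 + Rabs a / b) / (INR n + 1)))
      by (field; lra).
    apply Rmult_le_compat; auto using Rabs_pos.
Qed.

Lemma CV_disk_kummer_coef (a b r : R) : 0 < b -> CV_disk (kummer_coef a b) r.
Proof.
  intros Hb; unfold CV_disk.
  apply (@ex_series_le R_AbsRing R_CompleteNormedModule _
           (fun n => / INR (fact n) * ((1 + Rabs a / b) * Rabs r) ^ n)).
  - intros n; change (Rabs (Rabs (kummer_coef a b n * r ^ n))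
      <= / INR (fact n) * ((1 + Rabs a / b) * Rabs r) ^ n).
    rewrite Rabs_Rabsolu, Rabs_mult, Rpow_mult_distr, RPow_abs, <- Rmult_assoc.
    apply Rmult_le_compat_r; [apply Rabs_pos|].
    now apply Rabs_kummer_coef_le.
  - eexists.
    generalize (is_exp_Reals ((1 + Rabs a / b) * Rabs r)).
    unfold is_pseries; apply is_series_ext; intros n.
    rewrite pow_n_pow; unfold scal; simpl; unfold mult; simpl; ring.
Qed.

Lemma CV_radius_kummer_coef (a b : R) : 0 < b -> CV_radius (kummer_coef a b) = p_infty.
Proof.
  intros Hb.
  destruct (Lub_Rbar_correct (CV_disk (kummer_coef a b))) as [H _].
  fold (CV_radius (kummer_coef a b)) in H.
  destruct (CV_radius (kummer_coef a b)) as [l| |]; [|reflexivity|].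
  - generalize (H (l + 1) (CV_disk_kummer_coef a b _ Hb)); simpl; lra.
  - destruct (H 0 (CV_disk_kummer_coef a b _ Hb)).
Qed.

Lemma ex_pseries_kummer (a b s : R) : 0 < b -> ex_pseries (kummer_coef a b) s.
Proof.
  intros Hb; apply CV_radius_inside; now rewrite CV_radius_kummer_coef.
Qed.

Lemma is_derive_kummerM (a b s : R) : 0 < b ->
  is_derive (kummerM a b) s (a / b * kummerM (a + 1) (b + 1) s).
Proof.
  intros Hb.
  apply is_derive_ext with (PSeries (kummer_coef a b)).
  { intros; now rewrite kummerM_PSeries. }
  replace (a / b * kummerM (a + 1) (b + 1) s)
    with (PSeries (PS_derive (kummer_coef a b)) s).
  { apply is_derive_PSeries; now rewrite CV_radius_kummer_coef. }
  rewrite kummerM_PSeries, <- PSeries_scal.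
  apply PSeries_ext; intros n.
  change (INR (S n) * kummer_coef a b (S n) = a / b * kummer_coef (a + 1) (b + 1) n).
  unfold kummer_coef; rewrite (poch_S_l a), (poch_S_l b).
  generalize (poch_pos (b + 1) n ltac:(lra)) (INR_fact_lt_0 n) (pos_INR n); intros.
  change (fact (S n)) with (S n * fact n)%nat.
  rewrite mult_INR, S_INR; field; repeat split; lra.
Qed.

(** A contiguous relation, checked on coefficients: multiplication by [s] is a shift of index.
    Together with [kummerM_lower_b] it takes the place of Kummer's differential equation in all the
    derivative computations below. *)
Lemma kummerM_raise_a (a b s : R) : 0 < b ->
  s * kummerM (a + 1) (b + 1) s = b * (kummerM (a + 1) b s - kummerM a b s).
Proof.
  intros Hb; rewrite !kummerM_PSeries.
  rewrite <- PSeries_incr_1, <- PSeries_minus, <- PSeries_scal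
    by (apply ex_pseries_kummer; assumption).
  apply PSeries_ext; intros [|n].
  - unfold PS_incr_1, PS_scal, PS_minus, PS_opp, PS_plus, kummer_coef, scal, plus, opp; simpl.
    unfold mult, zero; simpl; lra.
  - change (kummer_coef (a + 1) (b + 1) n
            = b * (kummer_coef (a + 1) b (S n) + - kummer_coef a b (S n))).
    unfold kummer_coef.
    rewrite (poch_S_l a), (poch_S_l b).
    change (fact (S n)) with (S n * fact n)%nat.
    rewrite mult_INR, S_INR; simpl poch.
    generalize (poch_pos (b + 1) n ltac:(lra)) (INR_fact_lt_0 n) (pos_INR n); intros.
    field; repeat split; lra.
Qed.

Lemma kummerM_lower_b (a b s : R) : 0 < b ->
  a * s * kummerM (a + 1) (b + 2) s = b * (b + 1) * (kummerM a b s - kummerM a (b + 1) s).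
Proof.
  intros Hb; rewrite !kummerM_PSeries.
  replace (a * s * PSeries (kummer_coef (a + 1) (b + 2)) s)
     with (a * (s * PSeries (kummer_coef (a + 1) (b + 2)) s)) by ring.
  rewrite <- PSeries_incr_1, <- PSeries_minus, <- !PSeries_scal
    by (apply ex_pseries_kummer; lra).
  apply PSeries_ext; intros [|n].
  - unfold PS_incr_1, PS_scal, PS_minus, PS_opp, PS_plus, kummer_coef, scal, plus, opp; simpl.
    unfold mult, zero; simpl; lra.
  - change (a * kummer_coef (a + 1) (b + 2) n
            = b * (b + 1) * (kummer_coef a b (S n) + - kummer_coef a (b + 1) (S n))).
    unfold kummer_coef.
    rewrite (poch_S_l b), (poch_S_l a).
    assert (Hq : poch (b + 2) n = poch (b + 1) (S n) / (b + 1)).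
    { rewrite poch_S_l; replace (b + 1 + 1) with (b + 2) by ring; field; lra. }
    rewrite Hq.
    change (fact (S n)) with (S n * fact n)%nat.
    rewrite mult_INR, S_INR; simpl poch.
    generalize (poch_pos (b + 1) n ltac:(lra)) (INR_fact_lt_0 n) (pos_INR n); intros.
    field; repeat split; lra.
Qed.

(** * Self-similar solutions of [z dv/dx = d^2 v/dz^2] *)

(** The argument is invariant under x -> rho^3 x, z -> rho z, the scaling of the equation. The power
    of [x] has the same parameter [c] as the Kummer function so that differentiating in [x] only
    raises [c] and leaves [b] alone. *)
Definition kummerE (c b x z : R) : R :=
  Rpower x (- c) * kummerM c b (- z ^ 3 / (9 * x)).

Lemma Rpower_opp_succ (x c : R) : 0 < x -> Rpower x (- (c + 1)) = Rpower x (- c) / x.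
Proof.
  intros Hx; replace (- (c + 1)) with (- c + - (1)) by ring.
  rewrite Rpower_plus, (Rpower_Ropp x 1), Rpower_1; auto.
Qed.

(** The power contributes M(c,b) and the argument contributes s M(c+1,b+1); [kummerM_raise_a] merges
    the two into M(c+1,b). *)
Lemma is_derive_kummerE_x (c b x z : R) : 0 < x -> 0 < b ->
  is_derive (fun u => kummerE c b u z) x (- c * kummerE (c + 1) b x z).
Proof.
  intros Hx Hb.
  assert (HR : is_derive (fun u => Rpower u (- c)) x (- c * (Rpower x (- c) / x))).
  { unfold Rpower; auto_derive; [lra|]. field; lra. }
  assert (HS : is_derive (fun u => - z ^ 3 / (9 * u)) x (z ^ 3 / (9 * x) / x)).
  { auto_derive; [lra|]. field; lra. }
  generalize (is_derive_comp (kummerM c b) (fun u => - z ^ 3 / (9 * u)) x _ _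
    (is_derive_kummerM c b (- z ^ 3 / (9 * x)) Hb) HS).
  intros HM.
  generalize (is_derive_mult _ _ _ _ _ HR HM Rmult_comm); intros H.
  unfold kummerE; eapply is_derive_ext; [|eapply eq_rect; [exact H|]].
  - intros t; reflexivity.
  - unfold plus, mult, scal; simpl; unfold mult; simpl.
    fold (z ^ 3); change (z * (z * (z * 1))) with (z ^ 3).
    rewrite Rpower_opp_succ by assumption.
    generalize (kummerM_raise_a c b (- z ^ 3 / (9 * x)) Hb).
    set (s := - z ^ 3 / (9 * x)).
    replace (z ^ 3 / (9 * x) / x) with (- s / x) by (unfold s; field; lra).
    set (M1 := kummerM (c + 1) (b + 1) s); intros HM1.
    transitivity (- c * (Rpower x (- c) / x) * kummerM c b s
                  - Rpower x (- c) * (c / b) / x * (s * M1)); [field; lra|].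
    rewrite HM1; field; lra.
Qed.

Lemma is_derive_kummerE_z (c b x z : R) : 0 < x -> 0 < b ->
  is_derive (fun u => kummerE c b x u) z
    (- (c / (3 * b)) * z ^ 2 * kummerE (c + 1) (b + 1) x z).
Proof.
  intros Hx Hb.
  assert (HS : is_derive (fun u => - u ^ 3 / (9 * x)) z (- z ^ 2 / (3 * x))).
  { auto_derive; [lra|]. simpl; field; lra. }
  generalize (is_derive_comp (kummerM c b) (fun u => - u ^ 3 / (9 * x)) z _ _
    (is_derive_kummerM c b (- z ^ 3 / (9 * x)) Hb) HS).
  intros HM.
  generalize (is_derive_scal _ _ (Rpower x (- c)) _ HM); intros H.
  unfold kummerE; eapply eq_rect; [exact H|].
  rewrite Rpower_opp_succ by assumption.
  unfold scal; simpl; unfold mult; simpl.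
  field; lra.
Qed.

Lemma kummerE_raise_c (c b x z : R) : 0 < x -> 0 < b ->
  z ^ 3 * kummerE (c + 1) (b + 1) x z =
  9 * b * (kummerE c b x z - x * kummerE (c + 1) b x z).
Proof.
  intros Hx Hb; unfold kummerE; rewrite Rpower_opp_succ by assumption.
  generalize (kummerM_raise_a c b (- z ^ 3 / (9 * x)) Hb).
  set (s := - z ^ 3 / (9 * x)); set (M1 := kummerM (c + 1) (b + 1) s); intros H.
  transitivity (- 9 * Rpower x (- c) * (s * M1)); [unfold s; field; lra|].
  rewrite H; field; lra.
Qed.

Lemma kummerE_lower_b (c b x z : R) : 0 < x -> 0 < b ->
  c * z ^ 3 * kummerE (c + 1) (b + 2) x z =
  9 * b * (b + 1) * (kummerE c (b + 1) x z - kummerE c b x z).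
Proof.
  intros Hx Hb; unfold kummerE; rewrite Rpower_opp_succ by assumption.
  generalize (kummerM_lower_b c b (- z ^ 3 / (9 * x)) Hb).
  set (s := - z ^ 3 / (9 * x)); set (M1 := kummerM (c + 1) (b + 2) s); intros H.
  transitivity (- 9 * Rpower x (- c) * (c * s * M1)); [unfold s; field; lra|].
  rewrite H; field; lra.
Qed.

Lemma kummerE_homogeneous (c b x z rho : R) : 0 < x -> 0 < rho ->
  kummerE c b x (rho * z) = Rpower rho (- 3 * c) * kummerE c b (x / rho ^ 3) z.
Proof.
  intros Hx Hr; unfold kummerE.
  assert (Hr3 : 0 < rho ^ 3) by (apply pow_lt; assumption).
  replace (- z ^ 3 / (9 * (x / rho ^ 3))) with (- (rho * z) ^ 3 / (9 * x))
    by (field; split; lra).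
  rewrite <- Rmult_assoc; f_equal.
  replace (rho ^ 3) with (Rpower rho 3)
    by (replace 3 with (INR 3) by (simpl; ring); apply Rpower_pow; assumption).
  unfold Rdiv; rewrite <- Rpower_Ropp.
  rewrite <- (Rpower_mult_distr x) by (try assumption; apply exp_pos).
  rewrite (Rpower_mult rho).
  replace (- (3) * - c) with (- (- 3 * c)) by ring.
  rewrite (Rpower_Ropp rho (- 3 * c)).
  field; apply Rgt_not_eq, exp_pos.
Qed.

Lemma continuous_kummerE (c b x z : R) : 0 < x -> 0 < b ->
  continuous (fun p : R * R => kummerE c b (fst p) (snd p)) (x, z).
Proof.
  intros Hx Hb.
  assert (Cf : continuous (fun p : R * R => fst p) (x, z)) by apply continuous_fst.
  assert (Cs : continuous (fun p : R * R => snd p) (x, z)) by apply continuous_snd.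
  unfold kummerE; apply (continuous_mult (K := R_AbsRing)
    (fun p : R * R => Rpower (fst p) (- c))
    (fun p : R * R => kummerM c b (- snd p ^ 3 / (9 * fst p)))).
  - apply (continuous_comp (fun p : R * R => fst p) (fun u => Rpower u (- c))); [exact Cf|].
    apply (ex_derive_continuous (K := R_AbsRing) (V := R_NormedModule)); unfold Rpower; simpl; auto_derive; lra.
  - apply (continuous_comp (fun p : R * R => - snd p ^ 3 / (9 * fst p)) (kummerM c b)).
    + apply (continuous_mult (K := R_AbsRing)
        (fun p : R * R => - snd p ^ 3) (fun p : R * R => / (9 * fst p))).
      * apply (continuous_comp (fun p : R * R => snd p) (fun u => - u ^ 3)); [exact Cs|].
        apply (ex_derive_continuous (K := R_AbsRing) (V := R_NormedModule)); auto_derive; auto.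
      * apply (continuous_comp (fun p : R * R => fst p) (fun u => / (9 * u))); [exact Cf|].
        apply (ex_derive_continuous (K := R_AbsRing) (V := R_NormedModule)); simpl; auto_derive; lra.
    + apply (ex_derive_continuous (K := R_AbsRing) (V := R_NormedModule)).
      eexists; apply is_derive_kummerM; assumption.
Qed.

(* All self-similar solutions of degree [-3a] of [z dv/dx = d^2 v/dz^2] on [x > 0];
   [selfsim_z] is the derivative in [z]. *)
Definition selfsim (a al be x z : R) : R :=
  al * kummerE a (2/3) x z + be * z * kummerE (a + 1/3) (4/3) x z.

Definition selfsim_z (a al be x z : R) : R :=
  - (a / 2) * al * z ^ 2 * kummerE (a + 1) (5/3) x z + be * kummerE (a + 1/3) (1/3) x z.

Lemma is_derive_selfsim_x (a al be x z : R) : 0 < x ->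
  is_derive (fun u => selfsim a al be u z) x (selfsim (a + 1) (- a * al) (- (a + 1/3) * be) x z).
Proof.
  intros Hx.
  generalize (is_derive_plus _ _ _ _ _
    (is_derive_scal _ _ al _ (is_derive_kummerE_x a (2/3) x z Hx ltac:(lra)))
    (is_derive_scal _ _ (be * z) _ (is_derive_kummerE_x (a + 1/3) (4/3) x z Hx ltac:(lra)))).
  intros H; eapply eq_rect; [exact H|].
  unfold selfsim, plus; simpl.
  replace (a + 1 / 3 + 1) with (a + 1 + 1 / 3) by ring; ring.
Qed.

Lemma is_derive_selfsim_z_x (a al be x z : R) : 0 < x ->
  is_derive (fun u => selfsim_z a al be u z) x (selfsim_z (a + 1) (- a * al) (- (a + 1/3) * be) x z).
Proof.
  intros Hx.
  generalize (is_derive_plus _ _ _ _ _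
    (is_derive_scal _ _ (- (a / 2) * al * z ^ 2) _
       (is_derive_kummerE_x (a + 1) (5/3) x z Hx ltac:(lra)))
    (is_derive_scal _ _ be _ (is_derive_kummerE_x (a + 1/3) (1/3) x z Hx ltac:(lra)))).
  intros H; eapply eq_rect; [exact H|].
  unfold selfsim_z, plus; simpl.
  replace (a + 1 / 3 + 1) with (a + 1 + 1 / 3) by ring; field.
Qed.

(** Differentiating z E(a+1/3, 4/3) gives two terms. [kummerE_lower_b] at b = 1/3 fuses them into
    the single E(a+1/3, 1/3) of [selfsim_z], with no factor z left. *)
Lemma is_derive_selfsim_z (a al be x z : R) : 0 < x ->
  is_derive (fun u => selfsim a al be x u) z (selfsim_z a al be x z).
Proof.
  intros Hx.
  generalize (is_derive_plus _ _ _ _ _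
    (is_derive_scal _ _ al _ (is_derive_kummerE_z a (2/3) x z Hx ltac:(lra)))
    (is_derive_mult (fun u => be * u) _ _ _ _
       (is_derive_scal _ z be _ (is_derive_id z))
       (is_derive_kummerE_z (a + 1/3) (4/3) x z Hx ltac:(lra)) Rmult_comm)).
  intros H; eapply eq_rect; [exact H|].
  unfold selfsim_z, plus, mult, one; simpl.
  replace (2 / 3 + 1) with (5 / 3) by field.
  generalize (kummerE_lower_b (a + 1/3) (1/3) x z Hx ltac:(lra)); intros HE.
  replace (1 / 3 + 2) with (4 / 3 + 1) in HE by field.
  replace (1 / 3 + 1) with (4 / 3) in HE by field.
  nra.
Qed.

(** The factor of [z] on the right is the derivative in [x] found in [is_derive_selfsim_x], so this
    is the partial differential equation itself. The same fusion is used, now at b = 2/3. *)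
Lemma is_derive_selfsim_z_z (a al be x z : R) : 0 < x ->
  is_derive (fun u => selfsim_z a al be x u) z
    (z * selfsim (a + 1) (- a * al) (- (a + 1/3) * be) x z).
Proof.
  intros Hx.
  assert (Hz : is_derive (fun u => - (a / 2) * al * u ^ 2) z (- a * al * z)).
  { auto_derive; [auto|]. field. }
  generalize (is_derive_plus _ _ _ _ _
    (is_derive_mult _ _ _ _ _ Hz
       (is_derive_kummerE_z (a + 1) (5/3) x z Hx ltac:(lra)) Rmult_comm)
    (is_derive_scal _ _ be _ (is_derive_kummerE_z (a + 1/3) (1/3) x z Hx ltac:(lra)))).
  intros H; eapply eq_rect; [exact H|].
  unfold selfsim, plus, mult; simpl.
  generalize (kummerE_lower_b (a + 1) (2/3) x z Hx ltac:(lra)); intros HE.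
  replace (2 / 3 + 2) with (5 / 3 + 1) in HE by field.
  replace (2 / 3 + 1) with (5 / 3) in HE by field.
  replace (1 / 3 + 1) with (4 / 3) by field.
  replace (a + 1 / 3 + 1) with (a + 1 + 1 / 3) by ring.
  assert (HE2 : kummerE (a + 1) (2/3) x z = kummerE (a + 1) (5/3) x z
     - (a + 1) * z ^ 3 * kummerE (a + 1 + 1) (5/3 + 1) x z / 10) by lra.
  rewrite HE2; field.
Qed.

(** The last term is 3x times the derivative in [x]. The contiguous relations reduce every Kummer
    function to second parameter 2/3 or 4/3, after which the identity is linear algebra. *)
Lemma selfsim_euler (a al be x z : R) : 0 < x ->
  z * selfsim_z a al be x z =
  - 3 * a * selfsim a al be x z - 3 * x * selfsim (a + 1) (- a * al) (- (a + 1/3) * be) x z.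
Proof.
  intros Hx; unfold selfsim, selfsim_z.
  generalize (kummerE_raise_c a (2/3) x z Hx ltac:(lra))
    (kummerE_raise_c (a + 1/3) (4/3) x z Hx ltac:(lra))
    (kummerE_lower_b (a + 1/3) (1/3) x z Hx ltac:(lra)).
  replace (2 / 3 + 1) with (5 / 3) by field.
  replace (1 / 3 + 2) with (4 / 3 + 1) by field.
  replace (1 / 3 + 1) with (4 / 3) by field.
  replace (a + 1 / 3 + 1) with (a + 1 + 1 / 3) by ring.
  intros H1 H2 H3.
  assert (H3' : kummerE (a + 1/3) (1/3) x z = kummerE (a + 1/3) (4/3) x z
     - (a + 1/3) * (9 * (4/3) * (kummerE (a + 1/3) (4/3) x z
          - x * kummerE (a + 1 + 1/3) (4/3) x z)) / 4).
  { rewrite <- H2; lra. }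
  rewrite H3'.
  replace (z * (- (a / 2) * al * z ^ 2 * kummerE (a + 1) (5 / 3) x z + be *
     (kummerE (a + 1 / 3) (4 / 3) x z - (a + 1 / 3) * (9 * (4 / 3) * (kummerE (a + 1 / 3) (4 / 3) x z
      - x * kummerE (a + 1 + 1 / 3) (4 / 3) x z)) / 4)))
   with (- (a / 2) * al * (z ^ 3 * kummerE (a + 1) (5 / 3) x z) + z * be *
     (kummerE (a + 1 / 3) (4 / 3) x z - (a + 1 / 3) * (9 * (4 / 3) * (kummerE (a + 1 / 3) (4 / 3) x z
      - x * kummerE (a + 1 + 1 / 3) (4 / 3) x z)) / 4)) by field.
  rewrite H1; field.
Qed.

Lemma selfsim_homogeneous (a al be x z rho : R) : 0 < x -> 0 < rho ->
  selfsim a al be x (rho * z) = Rpower rho (- 3 * a) * selfsim a al be (x / rho ^ 3) z.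
Proof.
  intros Hx Hr; unfold selfsim; rewrite !kummerE_homogeneous by assumption.
  replace (- 3 * (a + 1 / 3)) with (- 3 * a + - (1)) by field.
  rewrite Rpower_plus, (Rpower_Ropp rho 1), Rpower_1 by assumption.
  field; lra.
Qed.

Lemma continuous_selfsim (a al be x z : R) : 0 < x ->
  continuous (fun p : R * R => selfsim a al be (fst p) (snd p)) (x, z).
Proof.
  intros Hx; unfold selfsim.
  apply (continuous_plus (V := R_NormedModule)
    (fun p : R * R => al * kummerE a (2/3) (fst p) (snd p))
    (fun p : R * R => be * snd p * kummerE (a + 1/3) (4/3) (fst p) (snd p))).
  - apply (continuous_mult (K := R_AbsRing) (fun _ : R * R => al)); [apply continuous_const|].
    apply continuous_kummerE; lra.
  - apply (continuous_mult (K := R_AbsRing) (fun p : R * R => be * snd p)).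
    + apply (continuous_mult (K := R_AbsRing) (fun _ : R * R => be));
        [apply continuous_const|apply continuous_snd].
    + apply continuous_kummerE; lra.
Qed.

Lemma continuous_selfsim_z (a al be x z : R) : 0 < x ->
  continuous (fun p : R * R => selfsim_z a al be (fst p) (snd p)) (x, z).
Proof.
  intros Hx; unfold selfsim_z.
  apply (continuous_plus (V := R_NormedModule)
    (fun p : R * R => - (a / 2) * al * snd p ^ 2 * kummerE (a + 1) (5/3) (fst p) (snd p))
    (fun p : R * R => be * kummerE (a + 1/3) (1/3) (fst p) (snd p))).
  - apply (continuous_mult (K := R_AbsRing) (fun p : R * R => - (a / 2) * al * snd p ^ 2)).
    + apply (continuous_comp (fun p : R * R => snd p) (fun u => - (a / 2) * al * u ^ 2));
        [apply continuous_snd|].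
      apply (ex_derive_continuous (K := R_AbsRing) (V := R_NormedModule)); auto_derive; auto.
    + apply continuous_kummerE; lra.
  - apply (continuous_mult (K := R_AbsRing) (fun _ : R * R => be)); [apply continuous_const|].
    apply continuous_kummerE; lra.
Qed.

(** Differentiate Euler's identity in [z], replace the second derivative by [z] times the one in
    [x], multiply by [z], and apply Euler's identity to the function and to its derivative in [x].
    All derivatives in [z] disappear, leaving for fixed [z] an ordinary differential equation in
    [x]; the sign of [z ^ 3] decides how solutions behave at 0. *)
Lemma selfsim_ode (a al be x z : R) : 0 < x ->
  9 * x ^ 2 * selfsim (a + 2) (a * (a + 1) * al) ((a + 1/3) * (a + 4/3) * be) x z
  + ((12 + 18 * a) * x - z ^ 3) * selfsim (a + 1) (- a * al) (- (a + 1/3) * be) x z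
  + 3 * a * (3 * a + 1) * selfsim a al be x z = 0.
Proof.
  intros Hx.
  (* The right side of Euler's identity is differentiated in two ways: here through the product on
     its left side, in [H2] term by term. *)
  assert (H : forall s, is_derive (fun u => - 3 * a * selfsim a al be x u
            - 3 * x * selfsim (a + 1) (- a * al) (- (a + 1/3) * be) x u) s
         (selfsim_z a al be x s + s * (s * selfsim (a + 1) (- a * al) (- (a + 1/3) * be) x s))).
  { intros s; apply is_derive_ext with (fun u => u * selfsim_z a al be x u).
    { intros t; apply selfsim_euler; assumption. }
    generalize (is_derive_mult _ _ _ _ _ (is_derive_id s) (is_derive_selfsim_z_z a al be x s Hx) Rmult_comm).
    intros H; eapply eq_rect; [exact H|]. unfold plus, mult, one; simpl; ring. }
  generalize (is_derive_unique _ _ _ (H z)); intros H1.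
  assert (H2 : is_derive (fun u => - 3 * a * selfsim a al be x u
            - 3 * x * selfsim (a + 1) (- a * al) (- (a + 1/3) * be) x u) z
       (- 3 * a * selfsim_z a al be x z - 3 * x * selfsim_z (a + 1) (- a * al) (- (a + 1/3) * be) x z)).
  { apply (is_derive_minus (fun u => - 3 * a * selfsim a al be x u)
      (fun u => 3 * x * selfsim (a + 1) (- a * al) (- (a + 1/3) * be) x u));
    apply is_derive_scal; apply is_derive_selfsim_z; assumption. }
  rewrite (is_derive_unique _ _ _ H2) in H1.
  generalize (selfsim_euler a al be x z Hx)
    (selfsim_euler (a + 1) (- a * al) (- (a + 1/3) * be) x z Hx).
  replace (a + 1 + 1) with (a + 2) by ring.
  replace (- (a + 1) * (- a * al)) with (a * (a + 1) * al) by ring.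
  replace (- (a + 1 + 1 / 3) * (- (a + 1/3) * be)) with ((a + 1/3) * (a + 4/3) * be) by field.
  set (v0 := selfsim a al be x z) in *; set (v1 := selfsim (a + 1) _ _ x z) in *.
  set (v2 := selfsim (a + 2) _ _ x z) in *; set (z0 := selfsim_z a al be x z) in *.
  set (z1 := selfsim_z (a + 1) _ _ x z) in *.
  intros E0 E1.
  assert (H3 : (1 + 3 * a) * (z * z0) + z ^ 3 * v1 + 3 * x * (z * z1) = 0).
  { transitivity (z * ((z0 + z * (z * v1)) + 3 * a * z0 + 3 * x * z1)); [ring|].
    rewrite <- H1; ring. }
  rewrite E0, E1 in H3; nra.
Qed.

(** * The Gamma function *)

Lemma exp_nondecreasing (x y : R) : x <= y -> exp x <= exp y.
Proof.
  intros [H| ->]; [now apply Rlt_le, exp_increasing|apply Rle_refl].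
Qed.

(** This is ln u <= u - 1 at u = t/c. Exponentiated, it says that t^c e^(-t) never exceeds its
    maximum c^c e^(-c). *)
Lemma mul_ln_le (c t : R) : 0 < c -> 0 < t -> c * ln t <= t - c + c * ln c.
Proof.
  intros Hc Ht.
  assert (Htc : 0 < t / c) by now apply Rdiv_lt_0_compat.
  assert (Hln : ln (t / c) <= t / c - 1).
  { generalize (exp_ineq1_le (ln (t / c))); rewrite exp_ln by assumption; lra. }
  unfold Rdiv in Hln; rewrite ln_mult, ln_Rinv in Hln; try lra; [|now apply Rinv_0_lt_compat].
  apply Rmult_le_compat_l with (r := c) in Hln; [|lra].
  replace (c * (t * / c - 1)) with (t - c) in Hln by (field; lra).
  lra.
Qed.

Definition gamma_integrand (y t : R) : R := Rpower t (y - 1) * exp (- t).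

Lemma ex_RInt_gamma (y u w : R) : 0 < u -> u <= w -> ex_RInt (gamma_integrand y) u w.
Proof.
  intros Hu Huw; apply (ex_RInt_continuous (V := R_CompleteNormedModule)).
  intros t Ht; rewrite Rmin_left in Ht by assumption.
  apply (ex_derive_continuous (K := R_AbsRing) (V := R_NormedModule)).
  unfold gamma_integrand, Rpower; auto_derive; lra.
Qed.

Lemma gamma_integrand_pos (y t : R) : 0 < gamma_integrand y t.
Proof. apply Rmult_lt_0_compat; apply exp_pos. Qed.

Lemma RInt_gamma_ge_0 (y u w : R) : 0 < u -> u <= w -> 0 <= RInt (gamma_integrand y) u w.
Proof.
  intros Hu Huw; apply RInt_ge_0; [assumption|now apply ex_RInt_gamma|].
  intros; apply Rlt_le, gamma_integrand_pos.
Qed.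

Lemma RInt_gamma_mono (y u w u' w' : R) : 0 < u' -> u' <= u -> u <= w -> w <= w' ->
  RInt (gamma_integrand y) u w <= RInt (gamma_integrand y) u' w'.
Proof.
  intros H0 H1 H2 H3.
  rewrite <- (RInt_Chasles (gamma_integrand y) u' u w') by (apply ex_RInt_gamma; lra).
  rewrite <- (RInt_Chasles (gamma_integrand y) u w w') by (apply ex_RInt_gamma; lra).
  unfold plus; simpl.
  generalize (RInt_gamma_ge_0 y u' u H0 H1) (RInt_gamma_ge_0 y w w' ltac:(lra) H3); lra.
Qed.

(* Bounds [t^(y-1) e^-t] by [t^(y-1)] on (0,1] and by [C t^-2] on [1,oo). *)
Lemma RInt_gamma_bounded (y : R) : 0 < y ->
  exists B, forall u w, 0 < u -> u <= w -> RInt (gamma_integrand y) u w <= B.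
Proof.
  intros Hy.
  set (c := y + 1); set (C := exp (c * ln c - c)).
  exists (/ y + C); intros u w Hu Huw.
  set (u' := Rmin u 1); set (w' := Rmax w 1).
  assert (Hu' : 0 < u' <= 1).
  { unfold u', Rmin; destruct (Rle_dec u 1); lra. }
  assert (Hw' : 1 <= w') by apply Rmax_r.
  apply Rle_trans with (RInt (gamma_integrand y) u' w').
  { apply RInt_gamma_mono; try assumption; try lra; [apply Rmin_l|apply Rmax_l]. }
  rewrite <- (RInt_Chasles (gamma_integrand y) u' 1 w') by (apply ex_RInt_gamma; lra).
  apply Rplus_le_compat.
  - assert (HI : is_RInt (fun t => Rpower t (y - 1)) u' 1
               (minus (Rpower 1 y / y) (Rpower u' y / y))).
    { apply (is_RInt_derive (fun t => Rpower t y / y)).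
      - intros t Ht; rewrite Rmin_left in Ht by lra.
        unfold Rpower; auto_derive; [lra|].
        replace ((y - 1) * ln t) with (y * ln t + - ln t) by ring.
        rewrite exp_plus, exp_Ropp, exp_ln by lra; field; lra.
      - intros t Ht; rewrite Rmin_left in Ht by lra.
        apply (ex_derive_continuous (K := R_AbsRing) (V := R_NormedModule)).
        unfold Rpower; auto_derive; lra. }
    apply Rle_trans with (RInt (fun t => Rpower t (y - 1)) u' 1).
    + apply RInt_le; [lra|apply ex_RInt_gamma; lra|eexists; exact HI|].
      intros t Ht; unfold gamma_integrand.
      rewrite <- (Rmult_1_r (Rpower t (y - 1))) at 2.
      apply Rmult_le_compat_l; [apply Rlt_le, exp_pos|].
      rewrite <- exp_0; apply Rlt_le, exp_increasing; lra.
    + rewrite (is_RInt_unique _ _ _ _ HI).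
      unfold minus, plus, opp; simpl.
      assert (0 < Rpower u' y / y).
      { apply Rmult_lt_0_compat; [apply exp_pos|now apply Rinv_0_lt_compat]. }
      unfold Rpower at 1; rewrite ln_1, Rmult_0_r, exp_0; unfold Rdiv in *; lra.
  - assert (HI : is_RInt (fun t => C * / t ^ 2) 1 w' (minus (- C / w') (- C / 1))).
    { apply (is_RInt_derive (fun t => - C / t)).
      - intros t Ht; rewrite Rmin_left in Ht by lra.
        auto_derive; [lra|field; lra].
      - intros t Ht; rewrite Rmin_left in Ht by lra.
        apply (ex_derive_continuous (K := R_AbsRing) (V := R_NormedModule)).
        auto_derive; nra. }
    assert (HC : 0 < C) by apply exp_pos.
    apply Rle_trans with (RInt (fun t => C * / t ^ 2) 1 w').
    + apply RInt_le; [lra|apply ex_RInt_gamma; lra|eexists; exact HI|].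
      intros t Ht; unfold gamma_integrand, C, Rpower.
      replace (/ t ^ 2) with (exp (- (2 * ln t))).
      2:{ replace (- (2 * ln t)) with (- (ln t + ln t)) by ring.
          rewrite exp_Ropp, exp_plus, exp_ln by lra; f_equal; ring. }
      rewrite <- !exp_plus; apply exp_nondecreasing.
      generalize (mul_ln_le c t ltac:(unfold c; lra) ltac:(lra)); unfold c; lra.
    + rewrite (is_RInt_unique _ _ _ _ HI).
      unfold minus, plus, opp; simpl.
      assert (0 < C / w') by (apply Rmult_lt_0_compat; [|apply Rinv_0_lt_compat]; lra).
      replace (- C / w') with (- (C / w')) by (field; lra); lra.
Qed.

Local Notation at_0_infty := (filter_prod (at_right 0) (Rbar_locally p_infty)).

Lemma at_0_infty_ordered :
  at_0_infty (fun p => 0 < fst p /\ fst p <= snd p).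
Proof.
  apply (Filter_prod _ _ _ (fun u => 0 < u < 1) (fun w => 1 < w)).
  - exists (mkposreal 1 Rlt_0_1); intros u Hu H0.
    change (Rabs (u - 0) < 1) in Hu; apply Rabs_def2 in Hu; lra.
  - exists 1; tauto.
  - simpl; intros; lra.
Qed.

(** Integrals of a positive function increase with the interval; being bounded, they converge to
    their supremum. [RInt_gen] merely selects a limit, so this convergence is what gives [Gamma_pos]
    its meaning. *)
Lemma filterlim_RInt_gamma (y : R) : 0 < y ->
  filterlim (fun p : R * R => RInt (gamma_integrand y) (fst p) (snd p))
    at_0_infty (locally (Gamma_pos y)).
Proof.
  intros Hy.
  destruct (RInt_gamma_bounded y Hy) as [B HB].
  destruct (completeness (fun r => exists u w, 0 < u /\ u <= w /\
              r = RInt (gamma_integrand y) u w)) as [l [Hub Hlub]].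
  { exists B; intros r (u & w & H1 & H2 & ->); now apply HB. }
  { exists (RInt (gamma_integrand y) 1 1), 1, 1; repeat split; lra. }
  assert (Hl : filterlim (fun p : R * R => RInt (gamma_integrand y) (fst p) (snd p))
    at_0_infty (locally l)).
  { apply filterlim_locally; intros eps.
    destruct (Classical_Prop.classic (exists u w, 0 < u /\ u <= w /\
              l - eps < RInt (gamma_integrand y) u w)) as [(u0 & w0 & H1 & H2 & H3)|Hn].
    - apply (Filter_prod _ _ _ (fun u => 0 < u <= u0) (fun w => w0 < w)).
      + exists (mkposreal u0 H1); intros u Hu H0.
        change (Rabs (u - 0) < u0) in Hu; apply Rabs_def2 in Hu; lra.
      + exists w0; tauto.
      + simpl; intros u w [Hu1 Hu2] Hw; change (Rabs (RInt (gamma_integrand y) u w - l) < eps).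
        assert (RInt (gamma_integrand y) u0 w0 <= RInt (gamma_integrand y) u w)
          by (apply RInt_gamma_mono; lra).
        assert (RInt (gamma_integrand y) u w <= l).
        { apply Hub; exists u, w; repeat split; lra. }
        apply Rabs_def1; generalize (cond_pos eps); lra.
    - exfalso.
      assert (l <= l - eps); [|generalize (cond_pos eps); lra].
      apply Hlub; intros r (u & w & H1 & H2 & ->).
      apply Rnot_lt_le; intros H3; apply Hn; now exists u, w. }
  replace (Gamma_pos y) with l; [exact Hl|].
  symmetry; unfold Gamma_pos; fold (gamma_integrand y).
  refine (is_RInt_gen_unique (V := R_CompleteNormedModule) (Fa := at_right 0)
    (Fb := Rbar_locally p_infty) (gamma_integrand y) l _).
  intros P HP; generalize (filter_and (F := at_0_infty) _
    (fun p : R * R => P (RInt (gamma_integrand y) (fst p) (snd p))) at_0_infty_ordered (Hl P HP)).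
  apply (filter_imp (F := at_0_infty)); intros [u w]; simpl; intros [[H1 H2] H3].
  exists (RInt (gamma_integrand y) u w); split; [|exact H3].
  apply RInt_correct; now apply ex_RInt_gamma.
Qed.

Lemma Gamma_pos_gt_0 (y : R) : 0 < y -> 0 < Gamma_pos y.
Proof.
  intros Hy.
  apply Rlt_le_trans with (RInt (gamma_integrand y) 1 2).
  { apply RInt_gt_0; [lra| |].
    - intros; apply gamma_integrand_pos.
    - intros t Ht; apply (ex_derive_continuous (K := R_AbsRing) (V := R_NormedModule)).
      unfold gamma_integrand, Rpower; auto_derive; lra. }
  apply (filterlim_le (F := at_0_infty) (fun _ => RInt (gamma_integrand y) 1 2)
     (fun p : R * R => RInt (gamma_integrand y) (fst p) (snd p))
     (RInt (gamma_integrand y) 1 2) (Gamma_pos y)).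
  - apply (Filter_prod _ _ _ (fun u => 0 < u < 1) (fun w => 2 < w)).
    + exists (mkposreal 1 Rlt_0_1); intros u Hu H0.
      change (Rabs (u - 0) < 1) in Hu; apply Rabs_def2 in Hu; lra.
    + exists 2; tauto.
    + simpl; intros; apply RInt_gamma_mono; lra.
  - apply filterlim_const.
  - now apply filterlim_RInt_gamma.
Qed.

Lemma RInt_gamma_by_parts (y u w : R) : 0 < y -> 0 < u -> u <= w ->
  RInt (gamma_integrand (y + 1)) u w - y * RInt (gamma_integrand y) u w
  = Rpower u y * exp (- u) - Rpower w y * exp (- w).
Proof.
  intros Hy Hu Huw.
  assert (HI : is_RInt (fun t => gamma_integrand (y + 1) t - y * gamma_integrand y t) u w
     (minus (- (Rpower w y * exp (- w))) (- (Rpower u y * exp (- u))))).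
  { apply (is_RInt_derive (fun t => - (Rpower t y * exp (- t)))).
    - intros t Ht; rewrite Rmin_left in Ht by lra.
      unfold gamma_integrand, Rpower; auto_derive; [lra|].
      replace (y + 1 - 1) with y by ring.
      replace ((y - 1) * ln t) with (y * ln t + - ln t) by ring.
      rewrite exp_plus, (exp_Ropp (ln t)), exp_ln by lra; field; lra.
    - intros t Ht; rewrite Rmin_left in Ht by lra.
      apply (ex_derive_continuous (K := R_AbsRing) (V := R_NormedModule)).
      unfold gamma_integrand, Rpower; auto_derive; lra. }
  assert (HI2 : is_RInt (fun t => gamma_integrand (y + 1) t - y * gamma_integrand y t) u w
     (RInt (gamma_integrand (y + 1)) u w - y * RInt (gamma_integrand y) u w)).
  { apply (is_RInt_minus (V := R_NormedModule)
      (gamma_integrand (y + 1)) (fun t => y * gamma_integrand y t)).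
    - apply (RInt_correct (V := R_CompleteNormedModule)); now apply ex_RInt_gamma.
    - apply (is_RInt_scal (V := R_NormedModule) (gamma_integrand y)).
      apply (RInt_correct (V := R_CompleteNormedModule)); now apply ex_RInt_gamma. }
  rewrite <- (is_RInt_unique _ _ _ _ HI2), (is_RInt_unique _ _ _ _ HI).
  unfold minus, plus, opp; simpl; ring.
Qed.

Lemma filterlim_Rpower_at_right_0 (y : R) : 0 < y ->
  filterlim (fun u => Rpower u y * exp (- u)) (at_right 0) (locally 0).
Proof.
  intros Hy; apply filterlim_locally; intros eps.
  set (d := Rpower eps (/ y)).
  exists (mkposreal d (exp_pos _)); intros u Hu H0.
  change (Rabs (u - 0) < d) in Hu; apply Rabs_def2 in Hu.
  change (Rabs (Rpower u y * exp (- u) - 0) < eps).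
  rewrite Rminus_0_r, Rabs_right
    by (apply Rle_ge, Rlt_le, Rmult_lt_0_compat; apply exp_pos).
  apply Rle_lt_trans with (Rpower u y * 1).
  - apply Rmult_le_compat_l; [apply Rlt_le, exp_pos|].
    rewrite <- exp_0; apply exp_nondecreasing; lra.
  - rewrite Rmult_1_r.
    replace (pos eps) with (Rpower d y).
    + apply exp_increasing, Rmult_lt_compat_l; [lra|]; apply ln_increasing; lra.
    + unfold d; rewrite Rpower_mult, Rinv_l, Rpower_1; [reflexivity|apply cond_pos|lra].
Qed.

Lemma filterlim_Rpower_exp_p_infty (y : R) : 0 < y ->
  filterlim (fun w => Rpower w y * exp (- w)) (Rbar_locally p_infty) (locally 0).
Proof.
  intros Hy; apply filterlim_locally; intros eps.
  (* One power more than [y]: the bound w^(y+1) e^(-w) <= C leaves a factor 1/w to tend to 0. *)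
  set (c := y + 1); set (C := exp (c * ln c - c)).
  assert (HC : 0 < C) by apply exp_pos.
  assert (HCe : 0 < C / eps) by (apply Rmult_lt_0_compat; [|apply Rinv_0_lt_compat, cond_pos]; lra).
  exists (C / eps); intros w Hw.
  change (Rabs (Rpower w y * exp (- w) - 0) < eps).
  rewrite Rminus_0_r, Rabs_right
    by (apply Rle_ge, Rlt_le, Rmult_lt_0_compat; apply exp_pos).
  assert (Hle : Rpower w y * exp (- w) <= C / w).
  { replace (C / w) with (C * exp (- ln w)) by (rewrite exp_Ropp, exp_ln by lra; reflexivity).
    unfold C, Rpower; rewrite <- !exp_plus; apply exp_nondecreasing.
    generalize (mul_ln_le c w ltac:(unfold c; lra) ltac:(lra)); unfold c; lra. }
  apply Rle_lt_trans with (1 := Hle).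
  apply Rlt_div_l; [lra|].
  apply Rlt_div_l in Hw; [|apply cond_pos].
  lra.
Qed.

Lemma Gamma_pos_succ (y : R) : 0 < y -> Gamma_pos (y + 1) = y * Gamma_pos y.
Proof.
  intros Hy.
  assert (H0 : filterlim (fun p : R * R => RInt (gamma_integrand (y + 1)) (fst p) (snd p)
                  - y * RInt (gamma_integrand y) (fst p) (snd p))
           at_0_infty (locally (Gamma_pos (y + 1) - y * Gamma_pos y))).
  { apply (filterlim_comp_2 (F := at_0_infty)
      (fun p : R * R => RInt (gamma_integrand (y + 1)) (fst p) (snd p))
      (fun p : R * R => - (y * RInt (gamma_integrand y) (fst p) (snd p))) Rplus
      (G := locally (Gamma_pos (y + 1))) (H := locally (- (y * Gamma_pos y)))).
    - apply filterlim_RInt_gamma; lra.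
    - apply (filterlim_comp _ _ _ (fun p : R * R => y * RInt (gamma_integrand y) (fst p) (snd p))
        Ropp _ (locally (y * Gamma_pos y))).
      + apply (filterlim_comp _ _ _ (fun p : R * R => RInt (gamma_integrand y) (fst p) (snd p))
          (Rmult y) _ (locally (Gamma_pos y))); [now apply filterlim_RInt_gamma|].
        apply (filterlim_scal_r (K := R_AbsRing) (V := R_NormedModule) y).
      + apply (filterlim_opp (V := R_NormedModule)).
    - apply (filterlim_plus (V := R_NormedModule)). }
  assert (H1 : filterlim (fun p : R * R => RInt (gamma_integrand (y + 1)) (fst p) (snd p)
                  - y * RInt (gamma_integrand y) (fst p) (snd p))
           at_0_infty (locally (0 + - 0))).
  { apply filterlim_ext_loc with (fun p : R * R => Rpower (fst p) y * exp (- fst p)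
        + - (Rpower (snd p) y * exp (- snd p))).
    { generalize at_0_infty_ordered; apply filter_imp; intros [u w]; simpl; intros [Hu Huw].
      now rewrite RInt_gamma_by_parts. }
    apply (filterlim_comp_2 (F := at_0_infty)
      (fun p : R * R => Rpower (fst p) y * exp (- fst p))
      (fun p : R * R => - (Rpower (snd p) y * exp (- snd p))) Rplus
      (G := locally 0) (H := locally (- 0))).
    - apply (filterlim_comp _ _ _ (fun p : R * R => fst p)
        (fun u => Rpower u y * exp (- u)) _ (at_right 0)); [apply filterlim_fst|].
      now apply filterlim_Rpower_at_right_0.
    - apply (filterlim_comp _ _ _ (fun p : R * R => Rpower (snd p) y * exp (- snd p))
        Ropp _ (locally 0)); [|apply (filterlim_opp (V := R_NormedModule))].
      apply (filterlim_comp _ _ _ (fun p : R * R => snd p)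
        (fun u => Rpower u y * exp (- u)) _ (Rbar_locally p_infty)); [apply filterlim_snd|].
      now apply filterlim_Rpower_exp_p_infty.
    - apply (filterlim_plus (V := R_NormedModule)). }
  generalize (filterlim_locally_unique _ _ _ H0 H1); lra.
Qed.

(** Weighted AM-GM, or the tangent at [lam] to a concave power. Put L = ln(t/lam): the tangent to
    exp at th L bounds e^0 and e^L from below, and with weights 1-th and th these two bounds average
    to e^(th L). *)
Lemma Rpower_le_tangent (th lam t : R) : 0 <= th <= 1 -> 0 < lam -> 0 < t ->
  Rpower t th <= Rpower lam th * (1 - th + th * (t / lam)).
Proof.
  intros Hth Hl Ht.
  set (L := ln (t / lam)).
  assert (Htl : 0 < t / lam) by (apply Rmult_lt_0_compat; [|apply Rinv_0_lt_compat]; lra).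
  replace (t / lam) with (exp L) by (unfold L; now apply exp_ln).
  replace (Rpower t th) with (Rpower lam th * exp (th * L)).
  - apply Rmult_le_compat_l; [apply Rlt_le, exp_pos|].
    generalize (exp_ineq1_le (- (th * L))) (exp_ineq1_le (L - th * L)) (exp_pos (th * L)).
    replace (exp L) with (exp (th * L) * exp (L - th * L)) by (rewrite <- exp_plus; f_equal; ring).
    assert (exp (th * L) * exp (- (th * L)) = 1)
      by (rewrite <- exp_plus, Rplus_opp_r; apply exp_0).
    set (e := exp (th * L)) in *; set (e1 := exp (- (th * L))) in *;
    set (e2 := exp (L - th * L)) in *.
    intros H1 H2 H3.
    assert (1 >= e * (1 - th * L)) by nra.
    assert (e * e2 >= e * (1 + (L - th * L))) by nra.
    assert ((1 - th) * 1 >= (1 - th) * (e * (1 - th * L))) by (apply Rmult_ge_compat_l; lra).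
    assert (th * (e * e2) >= th * (e * (1 + (L - th * L)))) by (apply Rmult_ge_compat_l; lra).
    nra.
  - unfold Rpower, L, Rdiv; rewrite <- exp_plus, ln_mult, ln_Rinv; try lra.
    + f_equal; ring.
    + now apply Rinv_0_lt_compat.
Qed.

(** Half of Wendel's inequality, a form of log-convexity. The tangent bound at [lam = y] is
    integrated against the density of Gamma(y); since Gamma(y+1) = y Gamma(y), the two resulting
    terms add up to exactly y^th Gamma(y). *)
Lemma Gamma_pos_add_le (y th : R) : 0 < y -> 0 <= th <= 1 ->
  Gamma_pos (y + th) <= Rpower y th * Gamma_pos y.
Proof.
  intros Hy Hth.
  replace (Rpower y th * Gamma_pos y)
    with (Rpower y th * (1 - th) * Gamma_pos y + Rpower y th * th / y * Gamma_pos (y + 1))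
    by (rewrite Gamma_pos_succ by assumption; field; lra).
  apply (filterlim_le (F := at_0_infty)
     (fun p : R * R => RInt (gamma_integrand (y + th)) (fst p) (snd p))
     (fun p : R * R => Rpower y th * (1 - th) * RInt (gamma_integrand y) (fst p) (snd p)
       + Rpower y th * th / y * RInt (gamma_integrand (y + 1)) (fst p) (snd p))
     (Gamma_pos (y + th))
     (Rpower y th * (1 - th) * Gamma_pos y + Rpower y th * th / y * Gamma_pos (y + 1))).
  - generalize at_0_infty_ordered; apply filter_imp; intros [u w]; simpl; intros [Hu Huw].
    assert (HI : is_RInt (fun t => Rpower y th * (1 - th) * gamma_integrand y t
               + Rpower y th * th / y * gamma_integrand (y + 1) t) u w
       (Rpower y th * (1 - th) * RInt (gamma_integrand y) u w
       + Rpower y th * th / y * RInt (gamma_integrand (y + 1)) u w)).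
    { apply (is_RInt_plus (V := R_NormedModule)
        (fun t => Rpower y th * (1 - th) * gamma_integrand y t)
        (fun t => Rpower y th * th / y * gamma_integrand (y + 1) t));
      apply (is_RInt_scal (V := R_NormedModule));
      apply (RInt_correct (V := R_CompleteNormedModule)); now apply ex_RInt_gamma. }
    rewrite <- (is_RInt_unique _ _ _ _ HI).
    apply RInt_le; [assumption|now apply ex_RInt_gamma|eexists; exact HI|].
    intros t Ht; unfold gamma_integrand.
    replace (y + th - 1) with (th + (y - 1)) by ring.
    replace (y + 1 - 1) with (1 + (y - 1)) by ring.
    rewrite !Rpower_plus, Rpower_1 by lra.
    generalize (Rpower_le_tangent th y t Hth Hy ltac:(lra)); intros HT.
    replace (Rpower y th * (1 - th) * (Rpower t (y - 1) * exp (- t)) +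
      Rpower y th * th / y * (t * Rpower t (y - 1) * exp (- t)))
     with (Rpower y th * (1 - th + th * (t / y)) * (Rpower t (y - 1) * exp (- t)))
     by (field; lra).
    rewrite Rmult_assoc.
    apply Rmult_le_compat_r; [|exact HT].
    apply Rlt_le, Rmult_lt_0_compat; apply exp_pos.
  - apply filterlim_RInt_gamma; lra.
  - apply (filterlim_comp_2 (F := at_0_infty)
      (fun p : R * R => Rpower y th * (1 - th) * RInt (gamma_integrand y) (fst p) (snd p))
      (fun p : R * R => Rpower y th * th / y * RInt (gamma_integrand (y + 1)) (fst p) (snd p)) Rplus
      (G := locally (Rpower y th * (1 - th) * Gamma_pos y))
      (H := locally (Rpower y th * th / y * Gamma_pos (y + 1)))).
    + apply (filterlim_comp _ _ _ (fun p : R * R => RInt (gamma_integrand y) (fst p) (snd p))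
          (Rmult (Rpower y th * (1 - th))) _ (locally (Gamma_pos y)));
        [apply filterlim_RInt_gamma; lra|].
      apply (filterlim_scal_r (K := R_AbsRing) (V := R_NormedModule)).
    + apply (filterlim_comp _ _ _ (fun p : R * R => RInt (gamma_integrand (y + 1)) (fst p) (snd p))
          (Rmult (Rpower y th * th / y)) _ (locally (Gamma_pos (y + 1))));
        [apply filterlim_RInt_gamma; lra|].
      apply (filterlim_scal_r (K := R_AbsRing) (V := R_NormedModule)).
    + apply (filterlim_plus (V := R_NormedModule)).
Qed.

(** The other half of Wendel's inequality: the upper bound, started from y + th with the
    complementary exponent. *)
Lemma Gamma_pos_add_ge (y th : R) : 0 < y -> 0 <= th <= 1 ->
  y * Gamma_pos y <= Rpower (y + th) (1 - th) * Gamma_pos (y + th).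
Proof.
  intros Hy Hth; rewrite <- Gamma_pos_succ by assumption.
  replace (y + 1) with (y + th + (1 - th)) by ring.
  apply Gamma_pos_add_le; lra.
Qed.

Lemma Gamma_pos_poch (y : R) (n : nat) : 0 < y ->
  Gamma_pos (y + INR n) = poch y n * Gamma_pos y.
Proof.
  intros Hy; induction n as [|n IH].
  - simpl; rewrite Rplus_0_r; ring.
  - rewrite S_INR, <- Rplus_assoc, Gamma_pos_succ, IH by (generalize (pos_INR n); lra).
    simpl; ring.
Qed.

Lemma Gamma_of_pos (y : R) : 0 < y -> Gamma y = Gamma_pos y.
Proof.
  intros Hy; unfold Gamma.
  assert (H : (up (- y) <= 0)%Z).
  { destruct (archimed (- y)) as [_ H]; apply Z.lt_succ_r, lt_IZR; simpl; lra. }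
  (* [up (- y)] may be negative, in which case [Z.to_nat] truncates it to 0: no shift takes
     place. *)
  replace (Z.to_nat (up (- y))) with O by lia.
  simpl; rewrite Rplus_0_r; field.
Qed.

(** For y <= 0, passing from [y] to [y + 1] lowers the shift in the definition by exactly one, so
    both sides evaluate [Gamma_pos] at the same point and only the Pochhammer factors differ. The
    hypothesis says that [y] is not a pole. *)
Lemma Gamma_succ (y : R) : (forall n, y + INR n <> 0) -> Gamma (y + 1) = y * Gamma y.
Proof.
  intros Hn.
  destruct (Rlt_or_le 0 y) as [Hy|Hy].
  { rewrite !Gamma_of_pos by lra; now apply Gamma_pos_succ. }
  assert (Hy0 : y <> 0) by (generalize (Hn O); simpl; rewrite Rplus_0_r; auto).
  destruct (archimed (- y)) as [H1 H2].
  assert (Hu : (0 < up (- y))%Z) by (apply lt_IZR; simpl; lra).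
  assert (Hup : up (- (y + 1)) = (up (- y) - 1)%Z).
  { symmetry; apply tech_up; rewrite minus_IZR; lra. }
  unfold Gamma; rewrite Hup.
  replace (Z.to_nat (up (- y))) with (S (Z.to_nat (up (- y) - 1))) by lia.
  rewrite poch_S_l, S_INR.
  replace (y + (INR (Z.to_nat (up (- y) - 1)) + 1))
    with (y + 1 + INR (Z.to_nat (up (- y) - 1))) by ring.
  unfold Rdiv; rewrite Rinv_mult; generalize (/ poch (y + 1) (Z.to_nat (up (- y) - 1))).
  intros q; field; assumption.
Qed.

(** * Growth of the two Kummer solutions *)

Lemma Rle_div_intro_r (x y c : R) : 0 < c -> x * c <= y -> x <= y / c.
Proof. intros Hc; apply (Rle_div_r x y c Hc). Qed.

Lemma Rle_div_intro_l (x y c : R) : 0 < c -> x <= y * c -> x / c <= y.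
Proof. intros Hc; apply (Rle_div_l x y c Hc). Qed.

(** Kummer's coefficients scaled by Gamma(a)/Gamma(b). In this normalisation M(a, 2/3, s) and
    s^(1/3) M(a+1/3, 4/3, s) have the same leading growth e^s s^(a-2/3). *)
Definition gamma_coef (a b : R) (n : nat) : R :=
  Gamma_pos (a + INR n) / (Gamma_pos (b + INR n) * INR (fact n)).

Lemma gamma_coef_pos (a b : R) (n : nat) : 0 < a -> 0 < b -> 0 < gamma_coef a b n.
Proof.
  intros Ha Hb; generalize (pos_INR n) (INR_fact_lt_0 n); intros.
  apply Rdiv_lt_0_compat; [|apply Rmult_lt_0_compat; [|assumption]];
    apply Gamma_pos_gt_0; lra.
Qed.

Lemma gamma_coef_S (a b : R) (n : nat) : 0 < a -> 0 < b ->
  gamma_coef a b (S n) = gamma_coef a b n * (a + INR n) / ((b + INR n) * (INR n + 1)).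
Proof.
  intros Ha Hb; generalize (pos_INR n) (INR_fact_lt_0 n); intros.
  unfold gamma_coef; change (fact (S n)) with (S n * fact n)%nat.
  rewrite mult_INR, S_INR, <- !Rplus_assoc, !Gamma_pos_succ by lra.
  generalize (Gamma_pos_gt_0 (b + INR n) ltac:(lra)); intros.
  field; repeat split; lra.
Qed.

Lemma gamma_coef_kummer (a b : R) (n : nat) : 0 < a -> 0 < b ->
  gamma_coef a b n = Gamma_pos a / Gamma_pos b * kummer_coef a b n.
Proof.
  intros Ha Hb; unfold gamma_coef, kummer_coef; rewrite !Gamma_pos_poch by assumption.
  generalize (Gamma_pos_gt_0 b Hb) (poch_pos b n Hb) (INR_fact_lt_0 n); intros.
  field; repeat split; lra.
Qed.

Lemma is_series_gamma_coef (a b s : R) : 0 < a -> 0 < b ->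
  is_series (fun n => gamma_coef a b n * s ^ n) (Gamma_pos a / Gamma_pos b * kummerM a b s).
Proof.
  intros Ha Hb.
  apply is_series_ext with (fun n => Gamma_pos a / Gamma_pos b * (kummer_coef a b n * s ^ n)).
  { intros n; simpl; rewrite gamma_coef_kummer by assumption; ring. }
  apply (is_series_scal_l (K := R_AbsRing) (V := R_NormedModule) (Gamma_pos a / Gamma_pos b)).
  rewrite kummerM_PSeries.
  generalize (PSeries_correct _ _ (ex_pseries_kummer a b s Hb)).
  unfold is_pseries; apply is_series_ext; intros n.
  rewrite pow_n_pow; apply Rmult_comm.
Qed.

Lemma Rpower_cube (x th : R) : 0 < x -> Rpower (x ^ 3) th = Rpower x (3 * th).
Proof.
  intros Hx; rewrite <- Rpower_pow by assumption.
  rewrite Rpower_mult; f_equal; simpl; ring.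
Qed.

(* With [p n] the terms on the right and [q n] those on the left, log-convexity of Gamma gives
   [q n <= p n^(2/3) p(n+1)^(1/3) (1 + O(1/n))], and weighted AM-GM makes this linear in [p];
   the [O(1/n)] error is absorbed by [p(n+2) / s]. *)
Lemma gamma_coef_upper (a s : R) (n : nat) : 1 <= a -> 0 < s ->
  gamma_coef (a + 1/3) (4/3) n * s ^ n * Rpower s (1/3) <=
  2/3 * (gamma_coef a (2/3) n * s ^ n) + 1/3 * (gamma_coef a (2/3) (S n) * s ^ S n)
  + 4/3 / s * (gamma_coef a (2/3) (S (S n)) * s ^ S (S n)).
Proof.
  intros Ha Hs.
  rewrite (gamma_coef_S a (2/3) (S n)), (gamma_coef_S a (2/3) n), S_INR by lra.
  set (N := INR n); assert (HN : 0 <= N) by apply pos_INR.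
  set (p := gamma_coef a (2/3) n * s ^ n).
  assert (Hp : 0 < p).
  { apply Rmult_lt_0_compat; [apply gamma_coef_pos; lra|now apply pow_lt]. }
  assert (H1 : gamma_coef (a + 1/3) (4/3) n * s ^ n * Rpower s (1/3)
     <= p * (Rpower (s * (a + N) * (N + 4/3)) (1/3) / (N + 2/3))).
  { rewrite <- !Rpower_mult_distr by nra.
    replace (p * (Rpower s (1 / 3) * Rpower (a + N) (1 / 3) * Rpower (N + 4 / 3) (1 / 3) / (N + 2 / 3)))
      with (gamma_coef a (2/3) n * Rpower (a + N) (1/3) * Rpower (N + 4/3) (1/3) / (N + 2/3)
             * s ^ n * Rpower s (1/3)) by (unfold p; field; lra).
    apply Rmult_le_compat_r; [apply Rlt_le, exp_pos|].
    apply Rmult_le_compat_r; [apply Rlt_le; now apply pow_lt|].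
    unfold gamma_coef; fold N.
    generalize (Gamma_pos_add_le (a + N) (1/3) ltac:(lra) ltac:(lra)).
    generalize (Gamma_pos_add_ge (N + 2/3) (2/3) ltac:(lra) ltac:(lra)).
    replace (a + N + 1/3) with (a + 1/3 + N) by ring.
    replace (N + 2/3 + 2/3) with (4/3 + N) by field.
    replace (1 - 2/3) with (1/3) by field.
    replace (2/3 + N) with (N + 2/3) by ring.
    replace (4/3 + N) with (N + 4/3) by ring.
    generalize (Gamma_pos_gt_0 (N + 2/3) ltac:(lra)) (Gamma_pos_gt_0 (N + 4/3) ltac:(lra))
      (INR_fact_lt_0 n) (Gamma_pos_gt_0 (a + N) ltac:(lra)) (exp_pos (1/3 * ln (a + N)))
      (exp_pos (1/3 * ln (N + 4/3))).
    fold (Rpower (a + N) (1/3)); fold (Rpower (N + 4/3) (1/3)).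
    set (g2 := Gamma_pos (N + 2/3)); set (g4 := Gamma_pos (N + 4/3));
    set (g1 := Gamma_pos (a + N)); set (g3 := Gamma_pos (a + 1/3 + N));
    set (F := INR (fact n)); set (r1 := Rpower (a + N) (1/3));
    set (r2 := Rpower (N + 4/3) (1/3)).
    intros.
    replace (g1 / (g2 * F) * r1 * r2 / (N + 2/3))
      with ((r1 * g1) * (r2 * g4) / (((N + 2/3) * g2) * g4 * F)) by (field; repeat split; lra).
    apply Rle_div_intro_r; [apply Rmult_lt_0_compat; [|assumption]; apply Rmult_lt_0_compat;
      [apply Rmult_lt_0_compat|]; lra|].
    replace (g3 / (g4 * F) * ((N + 2 / 3) * g2 * g4 * F)) with (g3 * ((N + 2/3) * g2))
      by (field; repeat split; lra).
    assert (0 < (N + 2/3) * g2) by (apply Rmult_lt_0_compat; lra).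
    assert (0 <= r1 * g1) by (apply Rlt_le, Rmult_lt_0_compat; lra).
    apply Rle_trans with (r1 * g1 * ((N + 2/3) * g2)).
    - apply Rmult_le_compat_r; lra.
    - apply Rmult_le_compat_l; lra. }
  apply Rle_trans with (1 := H1).
  (* The tangent is taken at a perfect cube: its cube root N + 2/3 cancels the denominator in
     [H1]. *)
  assert (H2 : Rpower (s * (a + N) * (N + 4/3)) (1/3)
     <= (N + 2/3) * (2/3 + 1/3 * (s * (a + N) * (N + 4/3) / (N + 2/3) ^ 3))).
  { generalize (Rpower_le_tangent (1/3) ((N + 2/3) ^ 3) (s * (a + N) * (N + 4/3)) ltac:(lra)
      ltac:(apply pow_lt; lra) ltac:(apply Rmult_lt_0_compat; [apply Rmult_lt_0_compat|]; lra)).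
    rewrite Rpower_cube by lra.
    replace (3 * (1/3)) with 1 by field; rewrite Rpower_1 by lra.
    replace (1 - 1/3) with (2/3) by field; auto. }
  apply Rle_trans with (p * (2/3 + 1/3 * (s * (a + N) * (N + 4/3) / (N + 2/3) ^ 3))).
  { apply Rmult_le_compat_l; [lra|]. apply Rle_div_intro_l; [lra|]. lra. }
  replace (1 / 3 * (gamma_coef a (2 / 3) n * (a + N) / ((2 / 3 + N) * (N + 1)) * s ^ S n))
    with (p * (1/3 * (s * (a + N) / ((N + 2/3) * (N + 1)))))
    by (unfold p; simpl pow; field; lra).
  replace (4 / 3 / s * (gamma_coef a (2 / 3) n * (a + N) / ((2 / 3 + N) * (N + 1)) * (a + (N + 1))
      / ((2 / 3 + (N + 1)) * (N + 1 + 1)) * s ^ S (S n)))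
    with (p * (1/3 * (s * (a + N) / ((N + 2/3) * (N + 1)) * (4 * (a + N + 1) / ((N + 5/3) * (N + 2))))))
    by (unfold p; simpl pow; field; lra).
  rewrite (Rmult_comm (2/3)), <- !Rmult_plus_distr_l.
  apply Rmult_le_compat_l; [lra|].
  rewrite Rplus_assoc, <- Rmult_plus_distr_l.
  apply Rplus_le_compat_l, Rmult_le_compat_l; [lra|].
  replace (s * (a + N) * (N + 4 / 3) / (N + 2 / 3) ^ 3)
    with (s * (a + N) / ((N + 2/3) * (N + 1)) * ((N + 4/3) * (N + 1) / (N + 2/3) ^ 2))
    by (field; lra).
  set (r := s * (a + N) / ((N + 2/3) * (N + 1))).
  assert (Hr : 0 < r) by (apply Rdiv_lt_0_compat; nra).
  rewrite <- (Rmult_1_r r) at 2; rewrite <- Rmult_plus_distr_l.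
  apply Rmult_le_compat_l; [lra|].
  (* Equality holds at N = 0, which fixes the 4; multiplied by the weight 1/3 it is the 4/3 of the
     statement. *)
  apply Rle_trans with (1 + 4 / (N + 2)).
  - apply Rle_div_intro_l; [nra|].
    replace ((1 + 4 / (N + 2)) * (N + 2/3) ^ 2) with ((N + 6) * (N + 2/3) ^ 2 / (N + 2))
      by (field; lra).
    apply Rle_div_intro_r; nra.
  - apply Rplus_le_compat_l.
    replace (4 * (a + N + 1) / ((N + 5/3) * (N + 2)))
      with (4 * ((a + N + 1) / (N + 5/3)) / (N + 2)) by (field; lra).
    apply Rmult_le_compat_r; [apply Rlt_le, Rinv_0_lt_compat; lra|].
    assert (1 <= (a + N + 1) / (N + 5/3)) by (apply Rle_div_intro_r; lra).
    lra.
Qed.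

(** The terms in 4/3 sit at fractional index n + 1/3 of the series in 2/3. Since n + 1 = 1/3 (n +
    1/3) + 2/3 (n + 4/3), log-convexity and AM-GM give the weights 1/3 and 2/3. The tangent point (N
    + 5/3)^3 makes the power 2/3 exact, and the extra 2/3 / s covers the excess of (N + 5/3)^2 / 3
    over (N + 1)(N + 4/3) / 3. *)
Lemma gamma_coef_lower (a s : R) (n : nat) : 1 <= a -> 0 < s ->
  gamma_coef a (2/3) (S n) * s ^ S n <=
  1/3 * (gamma_coef (a + 1/3) (4/3) n * s ^ n * Rpower s (1/3))
  + (2/3 + 2/3 / s) * (gamma_coef (a + 1/3) (4/3) (S n) * s ^ S n * Rpower s (1/3)).
Proof.
  intros Ha Hs.
  rewrite (gamma_coef_S (a + 1/3) (4/3) n) by lra.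
  set (N := INR n); assert (HN : 0 <= N) by apply pos_INR.
  set (q := gamma_coef (a + 1/3) (4/3) n * s ^ n * Rpower s (1/3)).
  assert (Hq : 0 < q).
  { apply Rmult_lt_0_compat; [|apply exp_pos].
    apply Rmult_lt_0_compat; [apply gamma_coef_pos; lra|now apply pow_lt]. }
  assert (H1 : gamma_coef a (2/3) (S n) * s ^ S n
     <= q * (Rpower (s * (a + 1/3 + N) * (N + 5/3)) (2/3) / ((N + 1) * (N + 4/3)))).
  { rewrite <- !Rpower_mult_distr by nra.
    assert (Hs3 : s = Rpower s (1/3) * Rpower s (2/3)).
    { rewrite <- Rpower_plus; replace (1/3 + 2/3) with 1 by field; now rewrite Rpower_1. }
    replace (q * (Rpower s (2 / 3) * Rpower (a + 1/3 + N) (2 / 3) * Rpower (N + 5 / 3) (2 / 3) / ((N + 1) * (N + 4/3))))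
      with (gamma_coef (a + 1/3) (4/3) n * Rpower (a + 1/3 + N) (2/3) * Rpower (N + 5/3) (2/3) / ((N + 1) * (N + 4/3))
             * (s ^ n * (Rpower s (1/3) * Rpower s (2/3)))) by (unfold q; field; lra).
    rewrite <- Hs3; replace (s ^ n * s) with (s ^ S n) by (simpl; ring).
    apply Rmult_le_compat_r; [apply Rlt_le; now apply pow_lt|].
    unfold gamma_coef; change (fact (S n)) with (S n * fact n)%nat.
    rewrite mult_INR, S_INR; fold N.
    generalize (Gamma_pos_add_le (a + 1/3 + N) (2/3) ltac:(lra) ltac:(lra)).
    generalize (Gamma_pos_add_ge (N + 4/3) (1/3) ltac:(lra) ltac:(lra)).
    replace (a + 1/3 + N + 2/3) with (a + (N + 1)) by field.
    replace (N + 4/3 + 1/3) with (N + 5/3) by field.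
    replace (1 - 1/3) with (2/3) by field.
    replace (2/3 + (N + 1)) with (N + 5/3) by field.
    replace (4/3 + N) with (N + 4/3) by ring.
    generalize (Gamma_pos_gt_0 (N + 5/3) ltac:(lra)) (Gamma_pos_gt_0 (N + 4/3) ltac:(lra))
      (INR_fact_lt_0 n) (Gamma_pos_gt_0 (a + 1/3 + N) ltac:(lra)) (exp_pos (2/3 * ln (a + 1/3 + N)))
      (exp_pos (2/3 * ln (N + 5/3))).
    fold (Rpower (a + 1/3 + N) (2/3)); fold (Rpower (N + 5/3) (2/3)).
    set (g5 := Gamma_pos (N + 5/3)); set (g4 := Gamma_pos (N + 4/3));
    set (g1 := Gamma_pos (a + 1/3 + N)); set (g3 := Gamma_pos (a + (N + 1)));
    set (F := INR (fact n)); set (r1 := Rpower (a + 1/3 + N) (2/3));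
    set (r2 := Rpower (N + 5/3) (2/3)).
    intros.
    replace (g1 / (g4 * F) * r1 * r2 / ((N + 1) * (N + 4/3)))
      with ((r1 * g1) * (r2 * g5) / (((N + 4/3) * g4) * (g5 * ((N + 1) * F))))
      by (field; repeat split; lra).
    assert (0 < (N + 4/3) * g4) by (apply Rmult_lt_0_compat; lra).
    assert (0 < g5 * ((N + 1) * F)) by (repeat apply Rmult_lt_0_compat; lra).
    apply Rle_div_intro_r; [now apply Rmult_lt_0_compat|].
    replace (g3 / (g5 * ((N + 1) * F)) * ((N + 4 / 3) * g4 * (g5 * ((N + 1) * F))))
      with (g3 * ((N + 4/3) * g4)) by (field; repeat split; lra).
    assert (0 <= r1 * g1) by (apply Rlt_le, Rmult_lt_0_compat; lra).
    apply Rle_trans with (r1 * g1 * ((N + 4/3) * g4)).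
    - apply Rmult_le_compat_r; lra.
    - apply Rmult_le_compat_l; lra. }
  apply Rle_trans with (1 := H1).
  assert (H2 : Rpower (s * (a + 1/3 + N) * (N + 5/3)) (2/3)
     <= (N + 5/3) ^ 2 * (1/3 + 2/3 * (s * (a + 1/3 + N) * (N + 5/3) / (N + 5/3) ^ 3))).
  { generalize (Rpower_le_tangent (2/3) ((N + 5/3) ^ 3) (s * (a + 1/3 + N) * (N + 5/3)) ltac:(lra)
      ltac:(apply pow_lt; lra) ltac:(apply Rmult_lt_0_compat; [apply Rmult_lt_0_compat|]; lra)).
    rewrite Rpower_cube by lra.
    replace (3 * (2/3)) with (INR 2) by (simpl; field); rewrite Rpower_pow by lra.
    replace (1 - 2/3) with (1/3) by field; auto. }
  apply Rle_trans with (q * ((N + 5/3) ^ 2 * (1/3 + 2/3 * (s * (a + 1/3 + N) * (N + 5/3) / (N + 5/3) ^ 3))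
     / ((N + 1) * (N + 4/3)))).
  { apply Rmult_le_compat_l; [lra|].
    apply Rmult_le_compat_r; [apply Rlt_le, Rinv_0_lt_compat; nra|exact H2]. }
  replace ((2 / 3 + 2 / 3 / s) * (gamma_coef (a + 1 / 3) (4 / 3) n * (a + 1 / 3 + N)
      / ((4 / 3 + N) * (N + 1)) * s ^ S n * Rpower s (1 / 3)))
    with (q * (2/3 * (s * (a + 1/3 + N)) + 2/3 * (a + 1/3 + N)) / ((N + 1) * (N + 4/3)))
    by (unfold q; simpl pow; field; lra).
  apply Rle_trans with (q * ((1/3 * ((N + 1) * (N + 4/3)) + 2/3 * (s * (a + 1/3 + N))
      + 2/3 * (N + 4/3)) / ((N + 1) * (N + 4/3)))).
  - apply Rmult_le_compat_l; [lra|].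
    apply Rmult_le_compat_r; [apply Rlt_le, Rinv_0_lt_compat; nra|].
    replace ((N + 5/3) ^ 2 * (1/3 + 2/3 * (s * (a + 1/3 + N) * (N + 5/3) / (N + 5/3) ^ 3)))
      with ((N + 5/3) ^ 2 / 3 + 2/3 * (s * (a + 1/3 + N))) by (field; lra).
    nra.
  - replace (1 / 3 * q + q * (2 / 3 * (s * (a + 1 / 3 + N)) + 2 / 3 * (a + 1 / 3 + N)) / ((N + 1) * (N + 4 / 3)))
      with (q * ((1/3 * ((N + 1) * (N + 4/3)) + 2/3 * (s * (a + 1/3 + N))
      + 2/3 * (a + 1/3 + N)) / ((N + 1) * (N + 4/3)))) by (field; lra).
    apply Rmult_le_compat_l; [lra|].
    apply Rmult_le_compat_r; [apply Rlt_le, Rinv_0_lt_compat; nra|lra].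
Qed.

(** * Comparison of the two normalised series *)

Lemma is_series_shift (u : nat -> R) (l : R) :
  is_series u l -> is_series (fun n => u (S n)) (l - u O).
Proof.
  intros H; apply (is_series_incr_1 (K := R_AbsRing) (V := R_NormedModule)).
  eapply eq_rect; [exact H|]. unfold plus; simpl; ring.
Qed.

Lemma is_series_Rle (u w : nat -> R) (l m : R) : (forall n, 0 <= u n <= w n) ->
  is_series u l -> is_series w m -> l <= m.
Proof.
  intros H Hu Hw; rewrite <- (is_series_unique _ _ Hu), <- (is_series_unique _ _ Hw).
  apply Series_le; [exact H|eexists; exact Hw].
Qed.

(** Sum the two termwise inequalities over n. The upper one gives T <= S + (4/3) S/s, hence T <= 3
    S; the lower one gives S - T <= p 0 + T/s, where p 0 <= S/s is the term lost to the shift. The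
    constant is 4 = 1 + 3. *)
Lemma kummer_connection_bound (a s : R) : 1 <= a -> 1 <= s ->
  let S := Gamma_pos a / Gamma_pos (2/3) * kummerM a (2/3) s in
  let T := Gamma_pos (a + 1/3) / Gamma_pos (4/3) * kummerM (a + 1/3) (4/3) s * Rpower s (1/3) in
  0 < S /\ Rabs (S - T) <= 4 * S / s.
Proof.
  intros Ha Hs S T.
  set (p := fun n => gamma_coef a (2/3) n * s ^ n).
  set (q := fun n => gamma_coef (a + 1/3) (4/3) n * s ^ n * Rpower s (1/3)).
  assert (Hp : is_series p S) by exact (is_series_gamma_coef a (2/3) s ltac:(lra) ltac:(lra)).
  assert (Hq : is_series q T).
  { exact (is_series_scal_r (Rpower s (1/3)) _ _
      (is_series_gamma_coef (a + 1/3) (4/3) s ltac:(lra) ltac:(lra))). }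
  assert (Pp : forall n, 0 < p n).
  { intros n; apply Rmult_lt_0_compat; [apply gamma_coef_pos; lra|apply pow_lt; lra]. }
  assert (Pq : forall n, 0 < q n).
  { intros n; apply Rmult_lt_0_compat; [|apply exp_pos].
    apply Rmult_lt_0_compat; [apply gamma_coef_pos; lra|apply pow_lt; lra]. }
  generalize (is_series_shift _ _ Hp); intros Hp1.
  generalize (is_series_shift _ _ Hp1); intros Hp2.
  generalize (is_series_shift _ _ Hq); intros Hq1.
  assert (Hz : forall u l, (forall n, 0 < u n) -> is_series u l -> 0 <= l).
  { intros u l Hu Hl; apply (is_series_Rle (fun _ => 0) u 0 l); [intros n; split; [lra|apply Rlt_le, Hu]| |exact Hl].
    generalize (is_series_scal_l (K := R_AbsRing) (V := R_NormedModule) 0 u l Hl); intros H0.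
    eapply is_series_ext; [|eapply eq_rect; [exact H0|]].
    - intros n; apply Rmult_0_l.
    - apply Rmult_0_l. }
  assert (HS2 := Hz _ _ (fun n => Pp _) Hp2).
  assert (HT1 := Hz _ _ (fun n => Pq _) Hq1).
  simpl in HS2.
  (* The first ratio is s a / (2/3), and a >= 2/3. This makes the dropped term [p O] of relative
     size 1/s. *)
  assert (Hp0 : p O * s <= p 1%nat).
  { unfold p; rewrite gamma_coef_S by lra; simpl.
    replace (gamma_coef a (2 / 3) 0 * (a + 0) / ((2 / 3 + 0) * (0 + 1)) * (s * 1))
      with (gamma_coef a (2/3) 0 * s * (a / (2/3))) by field.
    generalize (Pp O); unfold p; simpl; intros.
    rewrite Rmult_1_r in H |- *.
    rewrite <- (Rmult_1_r (gamma_coef a (2/3) 0 * s)) at 1.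
    apply Rmult_le_compat_l; [apply Rmult_le_pos; lra|]. lra. }
  generalize (Pp O) (Pp 1%nat) (Pq O); intros P0 P1 Q0.
  assert (HS : p O * s <= S) by lra.
  assert (Hsi : 0 < / s <= 1).
  { split; [apply Rinv_0_lt_compat; lra|]. rewrite <- Rinv_1; apply Rinv_le_contravar; lra. }
  assert (HT : T <= S + 4/3 * S / s).
  { apply Rle_trans with (2/3 * S + 1/3 * (S - p O) + 4/3 / s * (S - p O - p 1%nat)).
    - apply (is_series_Rle q (fun n => 2/3 * p n + 1/3 * p (Datatypes.S n)
         + 4/3 / s * p (Datatypes.S (Datatypes.S n)))); [|exact Hq|].
      + intros n; split; [apply Rlt_le, Pq|]. exact (gamma_coef_upper a s n Ha ltac:(lra)).
      + exact (is_series_plus (K := R_AbsRing) (V := R_NormedModule) _ _ _ _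
          (is_series_plus (K := R_AbsRing) (V := R_NormedModule) _ _ _ _
            (is_series_scal_l (K := R_AbsRing) (V := R_NormedModule) (2/3) _ _ Hp)
            (is_series_scal_l (K := R_AbsRing) (V := R_NormedModule) (1/3) _ _ Hp1))
          (is_series_scal_l (K := R_AbsRing) (V := R_NormedModule) (4/3 / s) _ _ Hp2)).
    - unfold Rdiv in *; nra. }
  assert (HST : S - p O <= T + T / s).
  { apply Rle_trans with (1/3 * T + (2/3 + 2/3 / s) * (T - q O)).
    - apply (is_series_Rle (fun n => p (Datatypes.S n)) (fun n => 1/3 * q n
         + (2/3 + 2/3 / s) * q (Datatypes.S n))); [|exact Hp1|].
      + intros n; split; [apply Rlt_le, Pp|]. exact (gamma_coef_lower a s n Ha ltac:(lra)).
      + exact (is_series_plus (K := R_AbsRing) (V := R_NormedModule) _ _ _ _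
          (is_series_scal_l (K := R_AbsRing) (V := R_NormedModule) (1/3) _ _ Hq)
          (is_series_scal_l (K := R_AbsRing) (V := R_NormedModule) (2/3 + 2/3 / s) _ _ Hq1)).
    - unfold Rdiv in *; nra. }
  assert (S0 : 0 < S) by nra.
  split; [exact S0|].
  assert (Hp0S : p O <= S / s) by (apply Rle_div_intro_r; lra).
  unfold Rdiv in *.
  assert (T <= 3 * S) by nra.
  assert (T * / s <= 3 * S * / s) by (apply Rmult_le_compat_r; lra).
  assert (0 < S * / s) by (apply Rmult_lt_0_compat; lra).
  apply Rabs_le; lra.
Qed.

(** * Behaviour as [x] decreases to 0 *)

Lemma is_derive_selfsim_xx (a al be x z : R) : 0 < x ->
  is_derive (fun u => selfsim (a + 1) (- a * al) (- (a + 1/3) * be) u z) x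
    (selfsim (a + 2) (a * (a + 1) * al) ((a + 1/3) * (a + 4/3) * be) x z).
Proof.
  intros Hx.
  generalize (is_derive_selfsim_x (a + 1) (- a * al) (- (a + 1/3) * be) x z Hx).
  replace (a + 1 + 1) with (a + 2) by ring.
  replace (- (a + 1) * (- a * al)) with (a * (a + 1) * al) by ring.
  replace (- (a + 1 + 1 / 3) * (- (a + 1/3) * be)) with ((a + 1/3) * (a + 4/3) * be) by field.
  auto.
Qed.

Lemma mean_value (f df : R -> R) (x y : R) : x <= y ->
  (forall u, x <= u <= y -> is_derive f u (df u)) ->
  exists c, x <= c <= y /\ f y - f x = df c * (y - x).
Proof.
  intros Hxy Hd.
  destruct (MVT_gen f x y df) as [c [Hc He]].
  - rewrite Rmin_left, Rmax_right by assumption; intros; apply Hd; lra.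
  - rewrite Rmin_left, Rmax_right by assumption; intros u Hu.
    apply derivable_continuous_pt; exists (df u); apply is_derive_Reals, Hd, Hu.
  - rewrite Rmin_left, Rmax_right in Hc by assumption; now exists c.
Qed.

Definition bounded_near_0 (f : R -> R) : Prop :=
  exists B d, 0 < d /\ forall x, 0 < x <= d -> Rabs (f x) <= B.

(* [9 x^2 W'^2 + 3a(3a+1) W^2] is a Lyapunov function as [x] decreases to 0. *)
Lemma selfsim_bounded_right (a al be : R) : 0 < a -> bounded_near_0 (fun x => selfsim a al be x 1).
Proof.
  intros Ha.
  set (W := fun x => selfsim a al be x 1).
  set (W1 := fun x => selfsim (a + 1) (- a * al) (- (a + 1/3) * be) x 1).
  set (W2 := fun x => selfsim (a + 2) (a * (a + 1) * al) ((a + 1/3) * (a + 4/3) * be) x 1).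
  set (b := 3 * a * (3 * a + 1)); assert (Hb : 0 < b) by (unfold b; nra).
  set (E := fun x => 9 * x ^ 2 * W1 x ^ 2 + b * W x ^ 2).
  (* Below this point the factor 2 - (6 + 36a)x of the derivative of [E] is nonnegative, so [E] does
     not increase as [x] decreases. *)
  set (x1 := / (3 + 18 * a)); assert (Hx1 : 0 < x1) by (apply Rinv_0_lt_compat; lra).
  assert (HE : forall x, 0 < x -> is_derive E x (W1 x ^ 2 * (2 - (6 + 36 * a) * x))).
  { intros x Hx.
    assert (D0 : is_derive W x (W1 x)) by (apply is_derive_selfsim_x; assumption).
    assert (D1 : is_derive W1 x (W2 x)) by (apply is_derive_selfsim_xx; assumption).
    assert (O : 9 * x ^ 2 * W2 x + ((12 + 18 * a) * x - 1 ^ 3) * W1 x + b * W x = 0)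
      by (apply selfsim_ode; assumption).
    unfold E; auto_derive.
    - repeat split; eexists; eassumption.
    - rewrite (is_derive_unique (fun x : R => W x) _ _ D0), (is_derive_unique (fun x : R => W1 x) _ _ D1).
      transitivity (18 * x * W1 x ^ 2 + 2 * W1 x * (9 * x ^ 2 * W2 x + b * W x)); [ring|].
      replace (9 * x ^ 2 * W2 x + b * W x) with (- ((12 + 18 * a) * x - 1 ^ 3) * W1 x) by lra.
      ring. }
  (* b W^2 <= E, and |W| <= 1 + W^2 spares a square root. *)
  exists (1 + E x1 / b), x1; split; [exact Hx1|]; intros x Hx.
  destruct (mean_value E _ x x1 ltac:(lra) (fun u Hu => HE u ltac:(lra))) as [c [Hc Hm]].
  assert (Hc2 : 0 <= 2 - (6 + 36 * a) * c).
  { assert ((3 + 18 * a) * c <= 1); [|lra].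
    replace 1 with ((3 + 18 * a) * x1) by (unfold x1; field; lra).
    apply Rmult_le_compat_l; lra. }
  assert (HEx : E x <= E x1).
  { assert (0 <= W1 c ^ 2 * (2 - (6 + 36 * a) * c) * (x1 - x)); [|lra].
    apply Rmult_le_pos; [apply Rmult_le_pos; [apply pow2_ge_0|assumption]|lra]. }
  assert (HW : W x ^ 2 <= E x1 / b).
  { apply Rle_div_intro_r; [assumption|].
    unfold E in HEx at 1.
    assert (0 <= 9 * x ^ 2 * W1 x ^ 2)
      by (apply Rmult_le_pos; [|apply pow2_ge_0]; generalize (pow2_ge_0 x); lra).
    lra. }
  fold (W x).
  apply Rabs_le; nra.
Qed.

(** * Boundedness at z = -1 by a maximum principle *)

Lemma second_derivative_min (h h1 : R -> R) (h2 c u w : R) :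
  u < c < w -> (forall x, u < x < w -> is_derive h x (h1 x)) -> is_derive h1 c h2 ->
  (forall x, u < x < w -> h c <= h x) -> h1 c = 0 /\ 0 <= h2.
Proof.
  intros Hc Hd Hd1 Hmin.
  assert (H0 : h1 c = 0).
  { assert (pr : derivable_pt_lim h c (h1 c)) by (apply is_derive_Reals, Hd, Hc).
    rewrite <- (deriv_minimum h u w c (exist _ _ pr)); try lra.
    - simpl; reflexivity.
    - intros; apply Hmin; lra. }
  split; [exact H0|].
  apply Rnot_lt_le; intros Hneg.
  apply is_derive_Reals in Hd1.
  destruct (Hd1 (- h2) ltac:(lra)) as [del Hdel].
  set (r := Rmin (del / 2) ((w - c) / 2)).
  assert (Hr : 0 < r) by (apply Rmin_glb_lt; [generalize (cond_pos del)|]; lra).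
  assert (Hr1 : r <= del / 2) by apply Rmin_l.
  assert (Hr2 : r <= (w - c) / 2) by apply Rmin_r.
  destruct (MVT_cor2 h h1 c (c + r)) as [e [Hm He]]; [lra| |].
  { intros x Hx; apply is_derive_Reals, Hd; lra. }
  assert (Hmin' := Hmin (c + r) ltac:(lra)).
  assert (He0 : e - c <> 0) by lra.
  assert (Hdist : Rabs (e - c) < del) by (rewrite Rabs_right; lra).
  generalize (Hdel (e - c) He0 Hdist).
  replace (c + (e - c)) with e by ring; rewrite H0, Rminus_0_r.
  intros Hq; apply Rabs_def2 in Hq.
  assert (Hq1 : h1 e / (e - c) * (e - c) < 0 * (e - c)) by (apply Rmult_lt_compat_r; lra).
  replace (h1 e / (e - c) * (e - c)) with (h1 e) in Hq1 by (field; lra).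
  nra.
Qed.

(* [1 - K x] is a strict supersolution: comparing [selfsim] with a multiple of it at a negative
   minimum of the quotient contradicts the equation. *)
Lemma selfsim_barrier (a al be K x1 C y : R) :
  0 < a -> 3 * a * (3 * a + 1) < K -> 0 < x1 -> K * x1 < 1 -> 0 <= C ->
  - (C * (1 - K * x1)) <= selfsim a al be x1 (-1) ->
  (exists d, 0 < d /\ forall x, 0 < x <= d -> 0 <= selfsim a al be x (-1)) ->
  0 < y <= x1 -> - (C * (1 - K * y)) <= selfsim a al be y (-1).
Proof.
  intros Ha HK Hx1 HKx HC Hend [d [Hd Hpos]] Hy.
  apply Rnot_lt_le; intros Hneg.
  set (W := fun x => selfsim a al be x (-1)).
  change (W y < - (C * (1 - K * y))) in Hneg.
  change (forall x, 0 < x <= d -> 0 <= W x) in Hpos.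
  change (- (C * (1 - K * x1)) <= W x1) in Hend.
  set (W1 := fun x => selfsim (a + 1) (- a * al) (- (a + 1/3) * be) x (-1)).
  set (W2 := fun x => selfsim (a + 2) (a * (a + 1) * al) ((a + 1/3) * (a + 4/3) * be) x (-1)).
  assert (HK0 : 0 < K) by (assert (0 < a * a) by nra; lra).
  assert (Hphi : forall x, x <= x1 -> 0 < 1 - K * x) by (intros; nra).
  set (u := Rmin d (y / 2)).
  assert (Hu0 : 0 < u) by (apply Rmin_glb_lt; lra).
  assert (Hud : u <= d) by apply Rmin_l.
  assert (Huy : u <= y / 2) by apply Rmin_r.
  set (eta := fun x => W x / (1 - K * x)).
  assert (D0 : forall x, 0 < x -> is_derive W x (W1 x)) by (intros; now apply is_derive_selfsim_x).
  assert (D1 : forall x, 0 < x -> is_derive W1 x (W2 x)) by (intros; now apply is_derive_selfsim_xx).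
  destruct (continuity_ab_min eta u x1) as [c [Hmin Hc]]; [lra| |].
  { intros x Hx; apply derivable_continuous_pt.
    assert (Hex : ex_derive eta x).
    { unfold eta; auto_derive; split; [eexists; apply D0; lra|].
      split; [|auto]; generalize (Hphi x); lra. }
    exists (Derive eta x); apply is_derive_Reals; now apply Derive_correct. }
  set (m := eta c) in *.
  assert (Hge : forall x, u <= x <= x1 -> m * (1 - K * x) <= W x).
  { intros x Hx; generalize (Hmin x Hx); fold m; intros H.
    apply Rmult_le_compat_r with (r := 1 - K * x) in H; [|generalize (Hphi x); lra].
    unfold eta in H; replace (W x / (1 - K * x) * (1 - K * x)) with (W x) in H; [exact H|].
    field; generalize (Hphi x); lra. }
  assert (Heq : W c = m * (1 - K * c)).
  { unfold m, eta; field; generalize (Hphi c); lra. }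
  (* A minimum below -C <= 0 cannot sit at [u], where W >= 0, nor at [x1], by the boundary
     hypothesis; it is therefore interior. *)
  assert (Hm : m < - C).
  { generalize (Hge y ltac:(lra)); intros H.
    apply Rnot_le_lt; intros Hle.
    generalize (Hphi y ltac:(lra)); nra. }
  assert (Hcu : u < c).
  { destruct (proj1 Hc) as [H|H]; [exact H|exfalso].
    generalize (Hpos u ltac:(lra)); rewrite H, Heq.
    generalize (Hphi c ltac:(lra)); nra. }
  assert (Hcx : c < x1).
  { destruct (proj2 Hc) as [H|H]; [exact H|exfalso].
    rewrite <- H, Heq in Hend.
    generalize (Hphi c ltac:(lra)); nra. }
  destruct (second_derivative_min (fun x => W x - m * (1 - K * x)) (fun x => W1 x + m * K)
    (W2 c) c u x1) as [H1 H2]; [lra| | | |].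
  - intros x Hx.
    apply (is_derive_ext (fun x => plus (W x) (- m + m * K * x))).
    { intros t; unfold plus; simpl; ring. }
    apply (is_derive_plus W (fun x => - m + m * K * x)); [apply D0; lra|].
    auto_derive; [auto|ring].
  - apply (is_derive_ext (fun x => plus (W1 x) (m * K))).
    { intros t; reflexivity. }
    eapply eq_rect; [apply (is_derive_plus W1 (fun _ => m * K)); [apply D1; lra|apply is_derive_const]|].
    unfold plus, zero; simpl; ring.
  - intros x Hx; rewrite Heq; generalize (Hge x ltac:(lra)); lra.
  - assert (O : 9 * c ^ 2 * W2 c + ((12 + 18 * a) * c - (-1) ^ 3) * W1 c
        + 3 * a * (3 * a + 1) * W c = 0) by (apply selfsim_ode; lra).
    rewrite Heq in O.
    assert (HW1 : W1 c = - m * K) by lra.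
    rewrite HW1 in O.
    set (b := 3 * a * (3 * a + 1)) in *.
    assert (Hb : 0 < b) by (unfold b; nra).
    assert (0 <= 9 * c ^ 2 * W2 c)
      by (apply Rmult_le_pos; [|assumption]; generalize (pow2_ge_0 c); lra).
    (* At the minimum W = m(1 - Kc) and W' = -mK, so the equation is a sum of a nonnegative term and
       -m > 0 times a quantity at least K - b > 0: it cannot vanish. *)
    assert (O2 : 9 * c ^ 2 * W2 c
       + - m * (K - b + K * ((12 + 18 * a) * c + b * c)) = 0) by (rewrite <- O; ring).
    assert (0 <= K * ((12 + 18 * a) * c + b * c)).
    { apply Rmult_le_pos; [lra|]. apply Rplus_le_le_0_compat; apply Rmult_le_pos; lra. }
    nra.
Qed.

Lemma selfsim_lin (a e al be x z : R) :
  selfsim a (e - al) (- be) x z = e * selfsim a 1 0 x z - selfsim a al be x z.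
Proof. unfold selfsim; ring. Qed.

(** A Phragmen-Lindelof argument. Writing S for the solution with coefficients 1 and 0, e'S - W is
    again a solution and is nonnegative as soon as C x <= e'. The barrier then yields W <= e'S + B
    with [B] independent of e', and e' is made small at the fixed point [y]. *)
Lemma selfsim_upper_bound_left (a al be C d : R) : 0 < a -> 0 < d -> 0 <= C ->
  (forall x, 0 < x <= d -> 0 <= selfsim a 1 0 x (-1) /\ selfsim a al be x (-1) <= C * x * selfsim a 1 0 x (-1)) ->
  exists B d', 0 < d' /\ forall x, 0 < x <= d' -> selfsim a al be x (-1) <= B.
Proof.
  intros Ha Hd HC HW.
  set (K := 3 * a * (3 * a + 1) + 1).
  assert (HK : 1 < K) by (unfold K; nra).
  set (x1 := Rmin d (/ (2 * K))).
  assert (HiK : 0 < / (2 * K)) by (apply Rinv_0_lt_compat; lra).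
  assert (Hx1 : 0 < x1) by (apply Rmin_glb_lt; lra).
  assert (Hx1d : x1 <= d) by apply Rmin_l.
  assert (HKx1 : K * x1 <= 1/2).
  { replace (1/2) with (K * / (2 * K)) by (field; lra).
    apply Rmult_le_compat_l; [lra|apply Rmin_r]. }
  (* As K x1 <= 1/2, the factor 1 - K x1 is at least 1/2, and the 2 makes the barrier dominate |W|
     at [x1]. *)
  set (B := 2 * Rabs (selfsim a al be x1 (-1))).
  assert (HB : 0 <= B) by (unfold B; generalize (Rabs_pos (selfsim a al be x1 (-1))); lra).
  exists B, x1; split; [exact Hx1|]; intros y Hy.
  destruct (HW y ltac:(lra)) as [Sy _].
  apply le_epsilon; intros e He.
  set (e' := e / (1 + selfsim a 1 0 y (-1))).
  assert (He' : 0 < e') by (apply Rdiv_lt_0_compat; lra).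
  assert (HS : e' * selfsim a 1 0 y (-1) <= e).
  { unfold e'; replace (e / (1 + selfsim a 1 0 y (-1)) * selfsim a 1 0 y (-1))
      with (e * selfsim a 1 0 y (-1) / (1 + selfsim a 1 0 y (-1))) by (field; lra).
    apply Rle_div_intro_l; [lra|]. nra. }
  assert (Hb : - (B * (1 - K * y)) <= selfsim a (e' - al) (- be) y (-1)).
  { apply (selfsim_barrier a (e' - al) (- be) K x1 B y); try assumption; try lra.
    - unfold K; lra.
    - rewrite selfsim_lin; destruct (HW x1 ltac:(lra)) as [Sx _].
      assert (0 <= e' * selfsim a 1 0 x1 (-1)) by (apply Rmult_le_pos; lra).
      generalize (Rle_abs (selfsim a al be x1 (-1))).
      assert (Rabs (selfsim a al be x1 (-1)) <= B * (1 - K * x1)).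
      { unfold B; generalize (Rabs_pos (selfsim a al be x1 (-1))); nra. }
      lra.
    - exists (Rmin d (e' / (1 + C))); split.
      { apply Rmin_glb_lt; [lra|apply Rdiv_lt_0_compat; lra]. }
      intros x [Hx0 Hx]; rewrite selfsim_lin.
      assert (Hxd : x <= d) by (apply Rle_trans with (1 := Hx), Rmin_l).
      assert (HxC : x <= e' / (1 + C)) by (apply Rle_trans with (1 := Hx), Rmin_r).
      destruct (HW x ltac:(lra)) as [Sx HWx].
      assert (HCx : C * x <= e').
      { apply Rle_trans with ((1 + C) * x); [nra|].
        replace e' with ((1 + C) * (e' / (1 + C))) by (field; lra).
        apply Rmult_le_compat_l; lra. }
      assert (C * x * selfsim a 1 0 x (-1) <= e' * selfsim a 1 0 x (-1)) by (apply Rmult_le_compat_r; lra).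
      lra. }
  rewrite selfsim_lin in Hb.
  assert (0 <= B * (K * y)) by (apply Rmult_le_pos; [|apply Rmult_le_pos]; lra).
  lra.
Qed.

Lemma selfsim_bounded_left (a al be C d : R) : 0 < a -> 0 < d -> 0 <= C ->
  (forall x, 0 < x <= d ->
     0 <= selfsim a 1 0 x (-1) /\ Rabs (selfsim a al be x (-1)) <= C * x * selfsim a 1 0 x (-1)) ->
  bounded_near_0 (fun x => selfsim a al be x (-1)).
Proof.
  intros Ha Hd HC HW.
  assert (Hopp : forall x, selfsim a (- al) (- be) x (-1) = - selfsim a al be x (-1))
    by (intros; unfold selfsim; ring).
  destruct (selfsim_upper_bound_left a al be C d Ha Hd HC) as (B1 & d1 & Hd1 & H1).
  { intros x Hx; destruct (HW x Hx) as [H2 H3]; split; [exact H2|].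
    apply Rabs_le_between in H3; lra. }
  destruct (selfsim_upper_bound_left a (- al) (- be) C d Ha Hd HC) as (B2 & d2 & Hd2 & H2).
  { intros x Hx; destruct (HW x Hx) as [H2 H3]; split; [exact H2|].
    rewrite Hopp; apply Rabs_le_between in H3; lra. }
  exists (Rmax B1 B2), (Rmin d1 d2); split; [now apply Rmin_glb_lt|].
  intros x Hx.
  assert (Hx1 : x <= d1) by (apply Rle_trans with (1 := proj2 Hx), Rmin_l).
  assert (Hx2 : x <= d2) by (apply Rle_trans with (1 := proj2 Hx), Rmin_r).
  generalize (H1 x ltac:(lra)) (H2 x ltac:(lra)) (Rmax_l B1 B2) (Rmax_r B1 B2).
  rewrite Hopp; intros; apply Rabs_le; lra.
Qed.

(** A bounded derivative makes [f] Lipschitz near 0, hence Cauchy along [at_right 0]. *)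
Lemma bounded_derivative_limit (f df : R -> R) :
  (forall x, 0 < x -> is_derive f x (df x)) -> bounded_near_0 df ->
  exists l, filterlim f (at_right 0) (locally l).
Proof.
  intros Hd (B & d & Hd0 & HB).
  apply (filterlim_locally_cauchy (U := R_CompleteSpace) (F := at_right 0)).
  intros eps.
  set (r := Rmin d (eps / (1 + Rabs B))).
  assert (HB0 := Rabs_pos B).
  assert (Hr : 0 < r).
  { apply Rmin_glb_lt; [lra|apply Rdiv_lt_0_compat; [apply cond_pos|lra]]. }
  assert (Hmain : forall u w, 0 < u <= w -> w < r -> Rabs (f w - f u) < eps).
  { intros u w Huw Hw.
    destruct (mean_value f df u w) as [c [Hc ->]]; [lra|intros; apply Hd; lra|].
    assert (Hrd : r <= d) by apply Rmin_l.
    assert (Hre : r <= eps / (1 + Rabs B)) by apply Rmin_r.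
    rewrite Rabs_mult, (Rabs_right (w - u)) by lra.
    assert (Hdf : Rabs (df c) <= 1 + Rabs B).
    { apply Rle_trans with B; [apply HB; lra|generalize (Rle_abs B); lra]. }
    apply Rle_lt_trans with ((1 + Rabs B) * w).
    - apply Rmult_le_compat; try lra; apply Rabs_pos.
    - replace (pos eps) with ((1 + Rabs B) * (eps / (1 + Rabs B))) by (field; lra).
      apply Rmult_lt_compat_l; lra. }
  exists (fun x => 0 < x < r); split.
  - exists (mkposreal r Hr); intros x Hx H0.
    change (Rabs (x - 0) < r) in Hx; apply Rabs_def2 in Hx; lra.
  - intros u w Hu Hw; change (Rabs (f w - f u) < eps).
    destruct (Rle_or_lt u w); [apply Hmain; lra|].
    rewrite Rabs_minus_sym; apply Hmain; lra.
Qed.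

Lemma limit_bounded_near_0 (f : R -> R) (l : R) :
  filterlim f (at_right 0) (locally l) -> bounded_near_0 f.
Proof.
  intros H.
  destruct (proj1 (filterlim_locally f l) H (mkposreal 1 Rlt_0_1)) as [d Hd].
  exists (Rabs l + 1), (d / 2); split; [generalize (cond_pos d); lra|].
  intros x Hx.
  assert (Hb : Rabs (f x - l) < 1).
  { apply (Hd x); [|lra]. change (Rabs (x - 0) < d).
    rewrite Rminus_0_r, Rabs_right; generalize (cond_pos d); lra. }
  generalize (Rabs_triang (f x - l) l); replace (f x - l + l) with (f x) by ring; lra.
Qed.

(** * The functions [v k] *)

(** Chosen so that the degree of homogeneity 1/2 + 3k equals -3a. *)
Definition v_a (k : Z) : R := - (1/6) - IZR k.

Definition v_alpha (k : Z) : R :=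
  Rpower 9 (1/6 + IZR k) * (Gamma (1/3) / Gamma (1/6 - IZR k)).

Definition v_beta (k : Z) : R :=
  - (Rpower 9 (1/6 + IZR k) / Rpower 9 (1/3) * (Gamma (- (1/3)) / Gamma (- (1/6) - IZR k))).

Definition vk (k : Z) : R -> R -> R := selfsim (v_a k) (v_alpha k) (v_beta k).
Definition vzk (k : Z) : R -> R -> R := selfsim_z (v_a k) (v_alpha k) (v_beta k).

(** Since 1 + t^2 = r^2 x^(-2/3), the powers of r cancel and the prefactor reduces to x^(1/6+k) =
    x^(-a). *)
Lemma v_eq_vk (k : Z) (x z : R) : 0 < x -> v k x z = vk k x z.
Proof.
  intros Hx; unfold v, vk, selfsim, Lambda, kummerE, v_alpha, v_beta, v_a.
  set (kR := IZR k); set (t := z * Rpower x (- (1/3))).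
  set (q := z ^ 2 + Rpower x (2/3)).
  assert (Hq : 0 < q).
  { unfold q; generalize (pow2_ge_0 z) (exp_pos (2/3 * ln x)); unfold Rpower; lra. }
  assert (Ht2 : 1 + t ^ 2 = q * Rpower x (- (2/3))).
  { unfold q, t; rewrite Rmult_plus_distr_r, <- Rpower_plus.
    replace (2/3 + - (2/3)) with 0 by ring; rewrite Rpower_O by assumption.
    replace (- (2/3)) with (- (1/3) + - (1/3)) by field; rewrite Rpower_plus; ring. }
  assert (Ht3 : - t ^ 3 / 9 = - z ^ 3 / (9 * x)).
  { replace (t ^ 3) with (z ^ 3 * / x); [field; lra|].
    unfold t; rewrite Rpow_mult_distr; f_equal.
    rewrite <- (Rpower_pow 3) by apply exp_pos; rewrite Rpower_mult.
    replace (- (1/3) * INR 3) with (- (1)) by (simpl; field).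
    rewrite Rpower_Ropp, Rpower_1 by assumption; reflexivity. }
  assert (Hpre : Rpower (sqrt q) (1/2 + 3 * kR) * Rpower (1 + t ^ 2) (- (1/4) - 3 * kR / 2)
            = Rpower x (1/6 + kR)).
  { rewrite Ht2, <- Rpower_sqrt, Rpower_mult, <- Rpower_mult_distr, Rpower_mult
      by (try assumption; apply exp_pos).
    rewrite <- Rmult_assoc, <- Rpower_plus.
    replace (/ 2 * (1/2 + 3 * kR) + (- (1/4) - 3 * kR / 2)) with 0 by field.
    rewrite Rpower_O, Rmult_1_l by assumption; f_equal; field. }
  rewrite Ht3.
  replace (- (- (1/6) - kR)) with (1/6 + kR) by field.
  replace (- (1/6) - kR + 1/3) with (1/6 - kR) by field.
  replace (- (1/6 - kR)) with (1/6 + kR + - (1/3)) by field.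
  rewrite (Rpower_plus (1/6 + kR) (- (1/3)) x), <- Hpre.
  assert (Rpower 9 (1/3) <> 0) by apply Rgt_not_eq, exp_pos.
  set (A1 := Gamma (1/3) / Gamma (1/6 - kR)).
  set (A2 := Gamma (- (1/3)) / Gamma (- (1/6) - kR)).
  set (W := Rpower (1 + t ^ 2) _); unfold t; field; assumption.
Qed.

(** [v_a k] lies in -1/6 + Z, hence is never a pole of Gamma and [Gamma_succ] applies for every [k].
    The next lemma does the same for the class 1/6 + Z. *)
Lemma v_a_add_neq_0 (k : Z) (n : nat) : v_a k + INR n <> 0.
Proof.
  unfold v_a; rewrite INR_IZR_INZ; intros H.
  assert (H6 : IZR (6 * (Z.of_nat n - k)) = IZR 1)
    by (rewrite mult_IZR, minus_IZR; lra).
  apply eq_IZR in H6; lia.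
Qed.

Lemma v_a_third_add_neq_0 (k : Z) (n : nat) : v_a k + 1/3 + INR n <> 0.
Proof.
  unfold v_a; rewrite INR_IZR_INZ; intros H.
  assert (H6 : IZR (6 * (k - Z.of_nat n)) = IZR 1)
    by (rewrite mult_IZR, minus_IZR; lra).
  apply eq_IZR in H6; lia.
Qed.

Lemma v_a_pred (k : Z) : v_a (k - 1) = v_a k + 1.
Proof. unfold v_a; rewrite minus_IZR; ring. Qed.

(** Differentiation in [x] multiplies [v_alpha] by -a and [v_beta] by -(a+1/3). Lowering [k] divides
    them by 9(a+1/3) and 9a respectively, by the functional equation of Gamma. Both therefore
    acquire this same constant, which is why the family is closed under differentiation. *)
Definition v_dx_coef (k : Z) : R := - 9 * v_a k * (v_a k + 1/3).

Lemma Rpower_9_pred (k : Z) : Rpower 9 (1/6 + IZR (k - 1)) = Rpower 9 (1/6 + IZR k) / 9.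
Proof.
  rewrite minus_IZR; replace (1/6 + (IZR k - 1)) with (1/6 + IZR k + - (1)) by ring.
  rewrite Rpower_plus, (Rpower_Ropp 9 1), Rpower_1 by lra; reflexivity.
Qed.

Lemma v_alpha_pred (k : Z) : - v_a k * v_alpha k = v_dx_coef k * v_alpha (k - 1).
Proof.
  unfold v_alpha, v_dx_coef; rewrite Rpower_9_pred.
  replace (1/6 - IZR (k - 1)) with (v_a k + 1/3 + 1) by (unfold v_a; rewrite minus_IZR; field).
  replace (1/6 - IZR k) with (v_a k + 1/3) by (unfold v_a; field).
  rewrite Gamma_succ by apply v_a_third_add_neq_0.
  unfold Rdiv; rewrite Rinv_mult.
  generalize (v_a_third_add_neq_0 k 0); simpl; rewrite Rplus_0_r; intros.
  generalize (/ Gamma (v_a k + 1 * / 3)); intros; field; lra.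
Qed.

Lemma v_beta_pred (k : Z) : - (v_a k + 1/3) * v_beta k = v_dx_coef k * v_beta (k - 1).
Proof.
  unfold v_beta, v_dx_coef; rewrite Rpower_9_pred.
  replace (- (1/6) - IZR (k - 1)) with (v_a k + 1) by (unfold v_a; rewrite minus_IZR; field).
  replace (- (1/6) - IZR k) with (v_a k) by (unfold v_a; field).
  rewrite Gamma_succ by apply v_a_add_neq_0.
  unfold Rdiv; rewrite Rinv_mult.
  generalize (v_a_add_neq_0 k 0); simpl; rewrite Rplus_0_r; intros.
  generalize (/ Gamma (v_a k)) (/ Rpower 9 (1 * / 3)); intros; field; lra.
Qed.

Lemma selfsim_pred (k : Z) (x z : R) :
  selfsim (v_a k + 1) (- v_a k * v_alpha k) (- (v_a k + 1/3) * v_beta k) x z = v_dx_coef k * vk (k - 1) x z.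
Proof.
  rewrite v_alpha_pred, v_beta_pred; unfold vk; rewrite v_a_pred; unfold selfsim; ring.
Qed.

Lemma selfsim_z_pred (k : Z) (x z : R) :
  selfsim_z (v_a k + 1) (- v_a k * v_alpha k) (- (v_a k + 1/3) * v_beta k) x z = v_dx_coef k * vzk (k - 1) x z.
Proof.
  rewrite v_alpha_pred, v_beta_pred; unfold vzk; rewrite v_a_pred; unfold selfsim_z; ring.
Qed.

(** At z = -1 one has v_k = D x^(-a) (S - T), with S and T as in [kummer_connection_bound] and s =
    1/(9x). The bound 4 S/s there becomes 36 x S, and x <= 1/9 is s >= 1. *)
Lemma vk_left_subdominant (k : Z) : (k <= -2)%Z ->
  exists C, 0 <= C /\ forall x, 0 < x <= 1/9 ->
    0 <= selfsim (v_a k) 1 0 x (-1) /\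
    Rabs (vk k x (-1)) <= C * x * selfsim (v_a k) 1 0 x (-1).
Proof.
  intros Hk; set (a := v_a k).
  assert (Ha : 1 <= a) by (unfold a, v_a; apply IZR_le in Hk; lra).
  set (Nk := Rpower 9 (1/6 + IZR k)).
  set (D := Nk * Gamma_pos (1/3) * Gamma_pos (2/3) / (Gamma_pos a * Gamma_pos (a + 1/3))).
  set (G := Gamma_pos a / Gamma_pos (2/3)).
  assert (G0 : forall y, 0 < y -> 0 < Gamma_pos y) by apply Gamma_pos_gt_0.
  assert (HN : 0 < Nk) by apply exp_pos.
  assert (HG : 0 < G) by (apply Rdiv_lt_0_compat; apply G0; lra).
  assert (HD : 0 < D).
  { apply Rdiv_lt_0_compat; repeat apply Rmult_lt_0_compat; try apply G0; lra. }
  exists (36 * D * G); split.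
  { apply Rmult_le_pos; [|lra]. apply Rmult_le_pos; lra. }
  intros x Hx.
  set (s := - (-1) ^ 3 / (9 * x)).
  assert (Hs : s = / (9 * x)) by (unfold s; field; lra).
  assert (Hs1 : 1 <= s).
  { rewrite Hs, <- Rinv_1; apply Rinv_le_contravar; lra. }
  destruct (kummer_connection_bound a s Ha Hs1) as [S0 HST].
  fold G in S0, HST; set (P := kummerM a (2/3) s) in *.
  set (T := _ * kummerM (a + 1/3) (4/3) s * _) in HST.
  assert (HP : 0 < P).
  { apply Rmult_lt_reg_l with G; [exact HG|]; rewrite Rmult_0_r; exact S0. }
  assert (HX : 0 < Rpower x (- a)) by apply exp_pos.
  assert (HV : selfsim a 1 0 x (-1) = Rpower x (- a) * P).
  { unfold selfsim, kummerE; fold s; fold P; ring. }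
  rewrite HV; split; [apply Rlt_le, Rmult_lt_0_compat; assumption|].
  assert (HW : vk k x (-1) = D * Rpower x (- a) * (G * P - T)).
  { unfold vk, selfsim, kummerE, v_alpha, v_beta; fold a Nk s P.
    replace (1/6 - IZR k) with (a + 1/3) by (unfold a, v_a; field).
    replace (- (1/6) - IZR k) with a by (unfold a, v_a; field).
    (* This negative value makes [v_beta] positive, so that at z = -1 the two growing terms are
       subtracted. *)
    assert (Hm : Gamma (- (1/3)) = - 3 * Gamma_pos (2/3)).
    { assert (H : Gamma (- (1/3) + 1) = - (1/3) * Gamma (- (1/3))).
      { apply Gamma_succ; intros [|n]; [simpl; lra|]. rewrite S_INR; generalize (pos_INR n); lra. }
      replace (- (1/3) + 1) with (2/3) in H by field.
      rewrite Gamma_of_pos in H by lra; lra. }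
    rewrite Hm, !Gamma_of_pos by lra.
    assert (HT : T = Gamma_pos (a + 1/3) / Gamma_pos (4/3) * kummerM (a + 1/3) (4/3) s
         * (/ Rpower 9 (1/3) * Rpower x (- (1/3)))).
    { unfold T; f_equal; rewrite Hs, <- !Rpower_Ropp, Rpower_mult_distr by lra.
      unfold Rpower; rewrite ln_Rinv by lra; f_equal; ring. }
    rewrite HT.
    replace (4/3) with (1/3 + 1) at 2 by field.
    rewrite Gamma_pos_succ by lra.
    replace (- (a + 1/3)) with (- a + - (1/3)) by ring; rewrite Rpower_plus.
    unfold D, G.
    generalize (G0 a ltac:(lra)) (G0 (a + 1/3) ltac:(lra)) (G0 (1/3) ltac:(lra))
      (G0 (2/3) ltac:(lra)) (exp_pos (1/3 * ln 9)); fold (Rpower 9 (1/3)); intros.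
    field; repeat split; lra. }
  rewrite HW, !Rabs_mult, (Rabs_right D), (Rabs_right (Rpower x (- a))) by lra.
  replace (36 * D * G * x * (Rpower x (- a) * P))
    with (D * Rpower x (- a) * (4 * (G * P) / s)) by (rewrite Hs; field; lra).
  apply Rmult_le_compat_l; [apply Rmult_le_pos; lra|exact HST].
Qed.

Lemma is_derive_vk_x (k : Z) (x z : R) : 0 < x ->
  is_derive (fun u => vk k u z) x (v_dx_coef k * vk (k - 1) x z).
Proof. intros Hx; rewrite <- selfsim_pred; now apply is_derive_selfsim_x. Qed.

Lemma is_derive_vzk_x (k : Z) (x z : R) : 0 < x ->
  is_derive (fun u => vzk k u z) x (v_dx_coef k * vzk (k - 1) x z).
Proof. intros Hx; rewrite <- selfsim_z_pred; now apply is_derive_selfsim_z_x. Qed.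

Lemma is_derive_vzk_z (k : Z) (x z : R) : 0 < x ->
  is_derive (fun u => vzk k x u) z (z * (v_dx_coef k * vk (k - 1) x z)).
Proof. intros Hx; rewrite <- selfsim_pred; now apply is_derive_selfsim_z_z. Qed.

Lemma bounded_near_0_scal (c : R) (f : R -> R) :
  bounded_near_0 f -> bounded_near_0 (fun x => c * f x).
Proof.
  intros (B & d & Hd & HB); exists (Rabs c * B), d; split; [exact Hd|].
  intros x Hx; rewrite Rabs_mult; apply Rmult_le_compat_l; [apply Rabs_pos|now apply HB].
Qed.

(* Boundedness propagates upwards in [k] by integrating [dv_k/dx = C v_(k-1)] in [x]. *)
Lemma vk_limit (k : Z) (e : R) : e = 1 \/ e = -1 ->
  exists l, filterlim (fun x => vk k x e) (at_right 0) (locally l).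
Proof.
  intros He.
  assert (Hlow : forall j, (j <= -2)%Z -> bounded_near_0 (fun x => vk j x e)).
  { intros j Hj.
    assert (Ha : 1 <= v_a j) by (unfold v_a; apply IZR_le in Hj; lra).
    destruct He as [-> | ->].
    - apply selfsim_bounded_right; lra.
    - destruct (vk_left_subdominant j Hj) as (C & HC & H).
      apply (selfsim_bounded_left (v_a j) (v_alpha j) (v_beta j) C (1/9)); try assumption; lra. }
  assert (Hstep : forall j, bounded_near_0 (fun x => vk (j - 1) x e) ->
    exists l, filterlim (fun x => vk j x e) (at_right 0) (locally l)).
  { intros j Hj.
    apply (bounded_derivative_limit _ (fun x => v_dx_coef j * vk (j - 1) x e)).
    - intros; now apply is_derive_vk_x.
    - now apply bounded_near_0_scal. }
  assert (Hall : forall n : nat, bounded_near_0 (fun x => vk (-2 + Z.of_nat n) x e)).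
  { induction n as [|n IH]; [apply Hlow; lia|].
    destruct (Hstep (-2 + Z.of_nat (S n))%Z) as [l Hl].
    - replace (-2 + Z.of_nat (S n) - 1)%Z with (-2 + Z.of_nat n)%Z by lia; exact IH.
    - exact (limit_bounded_near_0 _ l Hl). }
  apply Hstep.
  destruct (Z_le_gt_dec (k - 1) (-2)) as [H|H]; [now apply Hlow|].
  replace (k - 1)%Z with (-2 + Z.of_nat (Z.to_nat (k - 1 + 2)))%Z by lia.
  apply Hall.
Qed.

(** * Extension to the boundary *)

Definition continuous_in_Pstar (g : R * R -> R) (p : R * R) : Prop :=
  filterlim g (within Pstar (locally p)) (locally (g p)).

Lemma continuous_in_Pstar_of_continuous (g : R * R -> R) (p : R * R) :
  continuous g p -> continuous_in_Pstar g p.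
Proof.
  intros H; apply (filterlim_filter_le_1 (F := locally p)); [|exact H].
  apply filter_le_within.
Qed.

Lemma continuous_in_Pstar_ext (f g : R * R -> R) (p : R * R) : Pstar p ->
  locally p (fun q => Pstar q -> f q = g q) ->
  continuous_in_Pstar f p -> continuous_in_Pstar g p.
Proof.
  intros Hp Hloc Hf; unfold continuous_in_Pstar.
  rewrite <- (locally_singleton _ _ Hloc Hp).
  exact (filterlim_ext_loc (F := within Pstar (locally p)) f g Hloc Hf).
Qed.

Lemma continuous_in_Pstar_plus (f g : R * R -> R) (p : R * R) :
  continuous_in_Pstar f p -> continuous_in_Pstar g p ->
  continuous_in_Pstar (fun q => f q + g q) p.
Proof.
  intros Hf Hg.
  exact (filterlim_comp_2 (F := within Pstar (locally p)) f g Rplus Hf Hg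
    (filterlim_plus (V := R_NormedModule) (f p) (g p))).
Qed.

Lemma continuous_in_Pstar_mult (f g : R * R -> R) (p : R * R) :
  continuous_in_Pstar f p -> continuous_in_Pstar g p ->
  continuous_in_Pstar (fun q => f q * g q) p.
Proof.
  intros Hf Hg.
  exact (filterlim_comp_2 (F := within Pstar (locally p)) f g Rmult Hf Hg
    (filterlim_mult (K := R_AbsRing) (f p) (g p))).
Qed.

Definition extends_to_Pstar (f : R -> R -> R) : Prop :=
  exists g : R * R -> R,
    (forall p, Hplus p -> g p = f (fst p) (snd p)) /\
    (forall p, Pstar p -> continuous_in_Pstar g p).

Lemma locally_fst (x z : R) (P : R -> Prop) :
  locally x P -> locally (x, z) (fun q : R * R => P (fst q)).
Proof. intros H; exact (continuous_fst (U := R_UniformSpace) (V := R_UniformSpace) x z P H). Qed.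

Lemma locally_snd (x z : R) (P : R -> Prop) :
  locally z P -> locally (x, z) (fun q : R * R => P (snd q)).
Proof. intros H; exact (continuous_snd (U := R_UniformSpace) (V := R_UniformSpace) x z P H). Qed.

Lemma continuous_in_Pstar_interior (f : R -> R -> R) (g : R * R -> R) (x z : R) : 0 < x ->
  (forall p, Hplus p -> g p = f (fst p) (snd p)) ->
  continuous (fun p : R * R => f (fst p) (snd p)) (x, z) ->
  continuous_in_Pstar g (x, z).
Proof.
  intros Hx Hg Hf.
  apply continuous_in_Pstar_of_continuous.
  apply (continuous_ext_loc _ (fun p : R * R => f (fst p) (snd p))); [|exact Hf].
  generalize (locally_fst x z _ (open_gt 0 x Hx)); apply filter_imp.
  intros q Hq; symmetry; now apply Hg.
Qed.

(** Constant for u <= 0, so that continuity at 0 is two-sided and composition with maps of the plane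
    needs no restriction of the domain. *)
Definition extend_by (l : R) (W : R -> R) (u : R) : R := if Rlt_dec 0 u then W u else l.

Lemma continuous_extend_by (l : R) (W : R -> R) :
  filterlim W (at_right 0) (locally l) -> continuous (extend_by l W) 0.
Proof.
  intros H; unfold continuous; replace (extend_by l W 0) with l.
  2:{ unfold extend_by; destruct (Rlt_dec 0 0); [lra|reflexivity]. }
  apply filterlim_locally; intros eps.
  generalize (proj1 (filterlim_locally W l) H eps); unfold at_right, within.
  apply filter_imp; intros u Hu; unfold extend_by; destruct (Rlt_dec 0 u);
    [now apply Hu|apply ball_center].
Qed.

(** By homogeneity v(x, z) = |z|^(-3a) v(x/|z|^3, sign z). Near a boundary point z is not 0, so the
    right side depends continuously on (x, z) once v(., 1) and v(., -1) are extended to 0 by their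
    limits. *)
Lemma extends_vk (k : Z) : extends_to_Pstar (vk k).
Proof.
  destruct (vk_limit k 1 (or_introl eq_refl)) as [lp Hlp].
  destruct (vk_limit k (-1) (or_intror eq_refl)) as [lm Hlm].
  set (a := v_a k).
  set (g := fun p : R * R =>
    if Rlt_dec 0 (fst p) then vk k (fst p) (snd p)
    else if Rlt_dec 0 (snd p) then Rpower (snd p) (- 3 * a) * lp
    else Rpower (- snd p) (- 3 * a) * lm).
  assert (Hg : forall p, Hplus p -> g p = vk k (fst p) (snd p)).
  { intros p Hp; unfold g; destruct (Rlt_dec 0 (fst p)); [reflexivity|contradiction]. }
  exists g; split; [exact Hg|].
  intros [x z] Hp; assert (Hp' := Hp); destruct Hp' as [Hx Hne]; simpl in Hx.
  destruct Hx as [Hx|Hx].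
  { apply (continuous_in_Pstar_interior (vk k)); [exact Hx|exact Hg|now apply continuous_selfsim]. }
  subst x.
  assert (Hz : z <> 0) by (intros ->; now apply Hne).
  (* Both half-lines at once: [e] is the sign of [z], so e y = |y| nearby and y = (e y) e. *)
  assert (Hedge : forall e l, e * e = 1 -> 0 < e * z ->
     filterlim (fun x => vk k x e) (at_right 0) (locally l) ->
     (forall y, 0 < e * y -> g (0, y) = Rpower (e * y) (- 3 * a) * l) ->
     continuous_in_Pstar g (0, z)).
  { intros e l He Hez Hl Hgl.
    apply (continuous_in_Pstar_ext (fun q : R * R => Rpower (e * snd q) (- 3 * a)
       * extend_by l (fun x => vk k x e) (fst q / (e * snd q) ^ 3))); [exact Hp| |].
    - assert (Hop : locally z (fun y => 0 < e * y)).
      { apply (continuous_comp (fun y => e * y) (fun y => y) z); [| |now apply open_gt].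
        - apply (ex_derive_continuous (K := R_AbsRing) (V := R_NormedModule)); auto_derive; auto.
        - apply continuous_id. }
      generalize (locally_snd 0 z _ Hop); apply filter_imp.
      intros [x y] Hy [Hx _]; cbn [fst snd] in Hx, Hy |- *.
      assert (Hy3 : 0 < (e * y) ^ 3) by now apply pow_lt.
      unfold extend_by; destruct Hx as [Hx|Hx].
      + destruct (Rlt_dec 0 (x / (e * y) ^ 3)) as [_|Hn];
          [|exfalso; apply Hn; now apply Rdiv_lt_0_compat].
        rewrite Hg by exact Hx; simpl fst; simpl snd.
        replace y with (e * y * e) at 3 by (transitivity (e * e * y); [ring|rewrite He; ring]).
        symmetry; now apply selfsim_homogeneous.
      + subst x; destruct (Rlt_dec 0 (0 / (e * y) ^ 3)) as [Hn|_].
        * exfalso; unfold Rdiv in Hn; rewrite Rmult_0_l in Hn; lra.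
        * symmetry; now apply Hgl.
    - apply continuous_in_Pstar_of_continuous.
      assert (Cs : continuous (fun q : R * R => e * snd q) (0, z)).
      { apply (continuous_comp (fun q : R * R => snd q) (fun y => e * y));
          [apply continuous_snd|].
        apply (ex_derive_continuous (K := R_AbsRing) (V := R_NormedModule)); auto_derive; auto. }
      apply (continuous_mult (K := R_AbsRing) (fun q : R * R => Rpower (e * snd q) (- 3 * a))
        (fun q : R * R => extend_by l (fun x => vk k x e) (fst q / (e * snd q) ^ 3))).
      + apply (continuous_comp (fun q : R * R => e * snd q) (fun y => Rpower y (- 3 * a)));
          [exact Cs|].
        apply (ex_derive_continuous (K := R_AbsRing) (V := R_NormedModule)).
        unfold Rpower; simpl; auto_derive; lra.
      + apply (continuous_comp (fun q : R * R => fst q / (e * snd q) ^ 3)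
          (extend_by l (fun x => vk k x e))).
        * apply (continuous_mult (K := R_AbsRing) (fun q : R * R => fst q)
            (fun q : R * R => / (e * snd q) ^ 3)); [apply continuous_fst|].
          apply (continuous_comp (fun q : R * R => e * snd q) (fun y => / y ^ 3));
            [exact Cs|].
          apply (ex_derive_continuous (K := R_AbsRing) (V := R_NormedModule)).
          simpl snd; auto_derive; apply Rgt_not_eq, (pow_lt (e * z) 3 Hez).
        * simpl fst; simpl snd.
          replace (0 / (e * z) ^ 3) with 0 by (unfold Rdiv; ring).
          now apply continuous_extend_by. }
  destruct (Rlt_or_le 0 z) as [Hz0|Hz0].
  - apply (Hedge 1 lp); [ring|lra|exact Hlp|].
    intros y Hy; unfold g; simpl; destruct (Rlt_dec 0 0); [lra|].
    destruct (Rlt_dec 0 y); [|lra]. now rewrite Rmult_1_l.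
  - apply (Hedge (-1) lm); [ring|lra|exact Hlm|].
    intros y Hy; unfold g; simpl; destruct (Rlt_dec 0 0); [lra|].
    destruct (Rlt_dec 0 y); [lra|]. now replace (-1 * y) with (- y) by ring.
Qed.

(* Euler's identity expresses the extension of [dv_k/dz] through those of [v_k] and [v_(k-1)]. *)
Lemma extends_vzk (k : Z) : extends_to_Pstar (vzk k).
Proof.
  destruct (extends_vk k) as [g0 [E0 C0]].
  destruct (extends_vk (k - 1)) as [g1 [E1 C1]].
  set (h := fun p : R * R => (- 3 * v_a k * g0 p + - 3 * fst p * (v_dx_coef k * g1 p)) * / snd p).
  (* The quotient [h] is meaningless at z = 0, which occurs inside x > 0; there [vzk] itself is
     used. On the boundary of [Pstar] z is nonzero. *)
  set (g := fun p : R * R => if Rlt_dec 0 (fst p) then vzk k (fst p) (snd p) else h p).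
  assert (Hg : forall p, Hplus p -> g p = vzk k (fst p) (snd p)).
  { intros p Hp; unfold g; destruct (Rlt_dec 0 (fst p)); [reflexivity|contradiction]. }
  exists g; split; [exact Hg|].
  intros [x z] Hp; assert (Hp' := Hp); destruct Hp' as [Hx Hne]; simpl in Hx.
  destruct Hx as [Hx|Hx].
  { apply (continuous_in_Pstar_interior (vzk k)); [exact Hx|exact Hg|now apply continuous_selfsim_z]. }
  subst x.
  assert (Hz : z <> 0) by (intros ->; now apply Hne).
  assert (Hcst : forall c, continuous_in_Pstar (fun _ => c) (0, z))
    by (intros; apply continuous_in_Pstar_of_continuous, continuous_const).
  apply (continuous_in_Pstar_ext h); [exact Hp| |].
  - generalize (locally_snd 0 z _ (open_neq 0 z Hz)); apply filter_imp.
    intros [x y] Hy _; cbn [snd] in Hy.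
    unfold g; cbn [fst snd]; destruct (Rlt_dec 0 x) as [H0|H0]; [|reflexivity].
    unfold h; rewrite E0, E1 by exact H0; cbn [fst snd].
    apply Rmult_eq_reg_r with y; [|exact Hy].
    rewrite Rmult_assoc, Rinv_l, Rmult_1_r by exact Hy.
    rewrite (Rmult_comm (vzk k x y)); unfold vzk; rewrite selfsim_euler, selfsim_pred by exact H0.
    unfold vk; ring.
  - unfold h.
    apply continuous_in_Pstar_mult.
    + apply continuous_in_Pstar_plus.
      * apply continuous_in_Pstar_mult; [apply Hcst|now apply C0].
      * apply continuous_in_Pstar_mult.
        -- apply continuous_in_Pstar_mult; [apply Hcst|].
           apply continuous_in_Pstar_of_continuous, continuous_fst.
        -- apply continuous_in_Pstar_mult; [apply Hcst|now apply C1].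
    + apply continuous_in_Pstar_of_continuous.
      apply (continuous_comp (fun q : R * R => snd q) (fun y => / y)); [apply continuous_snd|].
      apply (ex_derive_continuous (K := R_AbsRing) (V := R_NormedModule)).
      simpl; auto_derive; exact Hz.
Qed.

(* Closed under both partial derivatives because [dv_k/dx = C_k v_(k-1)] and
   [d^2 v_k/dz^2 = z dv_k/dx]. *)
Inductive vclass : (R -> R -> R) -> Prop :=
| vclass_vk k : vclass (vk k)
| vclass_vzk k : vclass (vzk k)
| vclass_plus f g : vclass f -> vclass g -> vclass (fun x z => f x z + g x z)
| vclass_scal c f : vclass f -> vclass (fun x z => c * f x z)
| vclass_mulz f : vclass f -> vclass (fun x z => z * f x z).

Lemma vclass_derive (f : R -> R -> R) : vclass f ->
  exists fx fz, vclass fx /\ vclass fz /\ forall x z, 0 < x ->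
    is_derive (fun s => f s z) x (fx x z) /\ is_derive (fun s => f x s) z (fz x z).
Proof.
  induction 1 as [k|k|f g _ (fx & fz & F1 & F2 & F) _ (gx & gz & G1 & G2 & G)
                 |c f _ (fx & fz & F1 & F2 & F)|f F0 (fx & fz & F1 & F2 & F)].
  - exists (fun x z => v_dx_coef k * vk (k - 1) x z), (vzk k).
    split; [|split]; [apply vclass_scal, vclass_vk|apply vclass_vzk|].
    intros x z Hx; split; [now apply is_derive_vk_x|now apply is_derive_selfsim_z].
  - exists (fun x z => v_dx_coef k * vzk (k - 1) x z), (fun x z => z * (v_dx_coef k * vk (k - 1) x z)).
    split; [|split]; [apply vclass_scal, vclass_vzk
                     |apply (vclass_mulz (fun x z => v_dx_coef k * vk (k - 1) x z)), vclass_scal, vclass_vk|].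
    intros x z Hx; split; [now apply is_derive_vzk_x|now apply is_derive_vzk_z].
  - exists (fun x z => fx x z + gx x z), (fun x z => fz x z + gz x z).
    split; [|split]; [now apply vclass_plus|now apply vclass_plus|].
    intros x z Hx; destruct (F x z Hx) as [A1 A2]; destruct (G x z Hx) as [B1 B2].
    split; apply (is_derive_plus (K := R_AbsRing) (V := R_NormedModule)); assumption.
  - exists (fun x z => c * fx x z), (fun x z => c * fz x z).
    split; [|split]; [now apply vclass_scal|now apply vclass_scal|].
    intros x z Hx; destruct (F x z Hx) as [A1 A2].
    split; apply is_derive_scal; assumption.
  - exists (fun x z => z * fx x z), (fun x z => f x z + z * fz x z).
    split; [|split]; [now apply vclass_mulz
                     |apply (vclass_plus f (fun x z => z * fz x z)); [assumption|now apply vclass_mulz]|].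
    intros x z Hx; destruct (F x z Hx) as [A1 A2].
    split; [now apply is_derive_scal|].
    generalize (is_derive_mult _ _ _ _ _ (is_derive_id z) A2 Rmult_comm); intros H.
    eapply eq_rect; [exact H|]. unfold plus, mult, one; simpl; ring.
Qed.

Lemma vclass_continuous (f : R -> R -> R) (x z : R) : vclass f -> 0 < x ->
  continuous (fun p : R * R => f (fst p) (snd p)) (x, z).
Proof.
  intros Hf Hx; induction Hf as [k|k|f g _ Cf _ Cg|c f _ Cf|f _ Cf].
  - now apply continuous_selfsim.
  - now apply continuous_selfsim_z.
  - apply (continuous_plus (K := R_AbsRing) (V := R_NormedModule)
      (fun p : R * R => f (fst p) (snd p)) (fun p : R * R => g (fst p) (snd p))); assumption.
  - apply (continuous_mult (K := R_AbsRing) (fun _ : R * R => c)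
      (fun p : R * R => f (fst p) (snd p))); [apply continuous_const|assumption].
  - apply (continuous_mult (K := R_AbsRing) (fun p : R * R => snd p)
      (fun p : R * R => f (fst p) (snd p))); [apply continuous_snd|assumption].
Qed.

Lemma vclass_extends (f : R -> R -> R) : vclass f -> extends_to_Pstar f.
Proof.
  induction 1 as [k|k|f g _ (F & F1 & F2) _ (G & G1 & G2)|c f _ (F & F1 & F2)|f _ (F & F1 & F2)].
  - apply extends_vk.
  - apply extends_vzk.
  - exists (fun p => F p + G p); split.
    + intros p Hp; now rewrite F1, G1.
    + intros p Hp; apply continuous_in_Pstar_plus; auto.
  - exists (fun p => c * F p); split.
    + intros p Hp; now rewrite F1.
    + intros p Hp; apply continuous_in_Pstar_mult; auto.
      apply continuous_in_Pstar_of_continuous, continuous_const.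
  - exists (fun p => snd p * F p); split.
    + intros p Hp; now rewrite F1.
    + intros [x z] Hp; apply continuous_in_Pstar_mult; auto.
      apply continuous_in_Pstar_of_continuous, continuous_snd.
Qed.

(** Agreement on the open half-plane is enough to transfer derivatives: varying [x] requires only
    agreement near the point, varying [z] never leaves x > 0. This lets the induction on iterated
    [Derive] ignore the default values at x <= 0. *)
Lemma vclass_partials (f g : R -> R -> R) : vclass g ->
  (forall x z, 0 < x -> f x z = g x z) ->
  exists gx gz, vclass gx /\ vclass gz /\ forall x z, 0 < x ->
    is_derive (fun s => f s z) x (gx x z) /\ is_derive (fun s => f x s) z (gz x z).
Proof.
  intros Hg Hfg; destruct (vclass_derive g Hg) as (gx & gz & G1 & G2 & G).
  exists gx, gz; split; [exact G1|split; [exact G2|]].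
  intros x z Hx; destruct (G x z Hx) as [A1 A2]; split.
  - apply is_derive_ext_loc with (fun s => g s z); [|exact A1].
    generalize (open_gt 0 x Hx); apply filter_imp; intros y Hy; symmetry; now apply Hfg.
  - apply is_derive_ext with (fun s => g x s); [|exact A2].
    intros y; symmetry; now apply Hfg.
Qed.

Lemma pderiv_vclass (k : Z) (l : list bool) :
  exists g, vclass g /\ forall x z, 0 < x -> pderiv l (v k) x z = g x z.
Proof.
  induction l as [|b l (g & Hg & IH)]; simpl.
  - exists (vk k); split; [apply vclass_vk|]. intros; now apply v_eq_vk.
  - destruct (vclass_partials _ g Hg IH) as (gx & gz & G1 & G2 & G).
    destruct b; [exists gx|exists gz]; (split; [assumption|]);
      intros x z Hx; apply is_derive_unique; now apply G.
Qed.

Theorem lemma2p16 : forall k : Z, smooth_up_to_boundary (v k).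
Proof.
  intros k; split; [|split].
  - intros l b x z Hx.
    destruct (pderiv_vclass k l) as (g & Hg & Heq).
    destruct (vclass_partials _ g Hg Heq) as (gx & gz & _ & _ & G).
    destruct (G x z Hx) as [A1 A2]; destruct b; eexists; eassumption.
  - intros l x z Hx.
    destruct (pderiv_vclass k l) as (g & Hg & Heq).
    apply (continuous_ext_loc _ (fun p : R * R => g (fst p) (snd p)));
      [|now apply vclass_continuous].
    generalize (locally_fst x z _ (open_gt 0 x Hx)); apply filter_imp.
    intros p Hp; symmetry; now apply Heq.
  - intros l.
    destruct (pderiv_vclass k l) as (g & Hg & Heq).
    destruct (vclass_extends g Hg) as (G & G1 & G2).
    exists G; split; [|exact G2].
    intros p Hp; rewrite G1 by exact Hp; symmetry; now apply Heq.
Qed.
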